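(* $c_8=195955200$ and $c_9=13716864000$.
   Context: For a positive integer $n$, $\mathcal{A}_n$ denotes the set of $n\times n$ matrices with all entries in $\{0,1\}$. $d_n$ denotes the maximum of $\det A$ over $A\in\mathcal{A}_n$ ($d_8=56$ and $d_9=144$), and $c_n$ denotes the number of matrices $A\in\mathcal{A}_n$ with $\det A=d_n$. *)

(* Defs.v *)
From mathcomp Require Import all_boot all_order all_algebra.

Set Implicit Arguments.
Unset Strict Implicit.
Unset Printing Implicit Defensive.

Import Order.TTheory GRing.Theory Num.Theory.
Local Open Scope ring_scope.

(* The n x n matrices with entries in {0, 1} are indexed by the finite type
   'M[bool]_n; by [mx01_inj] and [mx01P], [mx01] is a bijection onto them. *)
Definition mx01 (n : nat) (B : 'M[bool]_n) : 'M[int]_n :=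
  map_mx (fun b : bool => (b : nat)%:Z) B.

Lemma mx01_inj (n : nat) : injective (@mx01 n).
Proof.
move=> A B /matrixP eqAB; apply/matrixP => i j.
by have := eqAB i j; rewrite !mxE; case: (A i j); case: (B i j).
Qed.

Lemma mx01P (n : nat) (A : 'M[int]_n) :
  (forall i j, A i j = 0 \/ A i j = 1) <-> exists B, A = mx01 B.
Proof.
split=> [A01 | [B ->] i j]; last by rewrite !mxE; case: (B i j); [right | left].
exists (map_mx (fun x : int => x == 1) A); apply/matrixP => i j.
by rewrite !mxE; case: (A01 i j) => ->.
Qed.

(* [B0] is only the witness of nonemptiness required by [arg max]. *)
Definition max_det01 (n : nat) : int :=
  let B0 : 'M[bool]_n := const_mx false in
  \det (mx01 [arg max_(B > B0) \det (mx01 B)]%O).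

Lemma max_det01_ge (n : nat) (B : 'M[bool]_n) :
  \det (mx01 B) <= max_det01 n.
Proof. by rewrite /max_det01; case: arg_maxP => // C _; apply. Qed.

Definition num_max_det01 (n : nat) : nat :=
  #|[set B : 'M[bool]_n | \det (mx01 B) == max_det01 n]|.

(* Main.v *)
Require Import Defs.
From Stdlib Require Import BinNat ZArith.
From mathcomp Require Import all_boot all_order all_algebra.
From mathcomp Require Import all_fingroup zify ssrZ ring lra.

Set Implicit Arguments.
Unset Strict Implicit.
Unset Printing Implicit Defensive.

Import Order.TTheory GRing.Theory Num.Theory.

(** Bordering an n x n 0/1 matrix B by a row and a column of zeros, and then
    replacing each entry b by (-1)^b, gives a sign matrix of order N = n + 1
    whose determinant is (-2)^n det B.  Flipping the signs of rows and columns
    makes every sign matrix of order N arise exactly 2^N 2^n times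
    ([card_large_det]).  So it is enough to find and to count the sign matrices
    C with |det C| >= 2^8 * 56 for N = 9, and with |det C| >= 2^9 * 144 for
    N = 10.

    This is done through the Gram matrix G = C C^T, which has determinant
    (det C)^2 and is positive definite with diagonal N.  Its other entries
    obey congruences: after a change of signs of the rows they are all 1 mod 4
    when N = 9, and when N = 10 they are 2 mod 4 between rows of the same
    parity and 0 mod 4 between rows of different parities ([gram_mod4]).  Two
    inequalities bound det G.  One is Fischer's inequality for a matrix split
    into two diagonal blocks ([fischer]).  The other is a bound of Ehlich type
    that keeps a small principal submatrix D exactly and estimates the rest
    ([ehlich_bound]).

    For N = 9, taking for D a submatrix with two off-diagonal entries different
    from 1 already brings the bound below (2^8 * 56)^2, and so does a single
    entry outside {1, -3, 5}.  So, up to signs, G = 8 I + J + t (E_xy + E_yx)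
    with t in {0, -4, 4} ([large_det9_pattern]).  The values t = 0 and t = -4
    are impossible: each column v of C satisfies v^T G^-1 v = 1, which has no
    solution in sign vectors.  For N = 10, Fischer's inequality followed by
    Barba's bound on each parity class gives at most (2^9 * 144)^2, with
    equality only if both classes have 5 rows and G is, up to signs, the block
    matrix diag (8 I + 2 J, 8 I + 2 J) ([large_det10_pattern]).  In both cases
    the optimal Gram matrices are described by a subset P of the rows, of size
    2 or 5, and by a choice of signs, and they have the same determinant.

    The count is a double count of the pairs (C, (P, s)) ([double_count]).
    Each optimal C belongs to 2 pairs (P, s) when N = 9 and to 8 when N = 10
    ([torsor9], [torsor10]), and the number X of matrices C with C C^T = G does
    not depend on (P, s).  Since C C^T = G means C^T G^-1 C = I, the columns of
    such a C are N solutions of v^T G^-1 v = 1 that are pairwise orthogonal for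
    G^-1.  Up to the signs and the order of the columns these are the cliques of
    size N of a graph on 37 vertices (N = 9) or 50 vertices (N = 10), and there
    are 30, respectively 120, of them ([card_gram_words]).  Hence
    X = 2^N N! 30 or 2^N N! 120; the powers of 2 cancel, and
      c_8 = C(9,2) * 9! * 30 / 2,   c_9 = C(10,5) * 10! * 120 / 8. *)

(** * Cliques *)

Section Cliques.

Fixpoint count_cliques (U : Type) (e : rel U) (m : nat) : seq U -> nat :=
  if m is m'.+1 then
    fix loop l := if l is v :: l' then
      count_cliques e m' (filter (e v) l') + loop l' else 0
  else fun=> 1.

Lemma count_cliques_nil U (e : rel U) m : count_cliques e m.+1 [::] = 0%N.
Proof. by []. Qed.

Lemma count_cliques_cons (U : Type) (e : rel U) m v l :
  count_cliques e m.+1 (v :: l) =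
  count_cliques e m (filter (e v) l) + count_cliques e m.+1 l.
Proof. by []. Qed.

Lemma count_cliques_map (U V : Type) (g : U -> V) (e : rel V) (e' : rel U) m l :
  (forall a b, e (g a) (g b) = e' a b) ->
  count_cliques e m (map g l) = count_cliques e' m l.
Proof.
move=> ee'; elim: m l => // m IHm; elim=> //= v l ->; congr (_ + _).
by rewrite filter_map (eq_filter (ee' v)) IHm.
Qed.

Variables (T : finType) (e : rel T).
Hypothesis sym_e : symmetric e.

Definition clique (S : {set T}) :=
  [forall x in S, forall y in S, (x != y) ==> e x y].

Lemma cliqueP (S : {set T}) : reflect {in S &, forall x y, x != y -> e x y} (clique S).
Proof.
apply: (iffP forall_inP) => [cS x y Sx Sy|cS x Sx].
  by have /forall_inP/(_ y Sy)/implyP := cS x Sx.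
by apply/forall_inP => y Sy; apply/implyP; apply: cS.
Qed.

Definition cliques_in (l : seq T) m :=
  [set S : {set T} | [&& S \subset l, #|S| == m & clique S]].

(** Splitting on the head v of the list: the cliques that contain v are v added to
    the cliques among the neighbours of v in the tail. *)
Lemma card_cliques_in l m : uniq l -> #|cliques_in l m| = count_cliques e m l.
Proof.
elim: m l => [|m IHm] l.
  move=> _; apply: (etrans _ (cards1 (set0 : {set T}))); apply: eq_card => S.
  rewrite !inE cards_eq0; have [->|] := eqVneq S set0; last by rewrite andbF.
  apply/andP; split; first by apply/subsetP => x; rewrite inE.
  by apply/cliqueP => x; rewrite inE.
elim: l => [_|v l IHl]; last rewrite cons_uniq count_cliques_cons => /andP[vl ul].
  apply/eqP; rewrite /= cards_eq0; apply/eqP/setP => S; rewrite !inE.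
  apply/negP => /and3P[/subsetP S0 /eqP cS _].
  have [x Sx] : exists x, x \in S by apply/card_gt0P; rewrite cS.
  by have := S0 x Sx.
rewrite -IHl // -IHm ?filter_uniq // -(cardsID [set S : {set T} | v \in S]).
congr (_ + _); last first.
  apply: eq_card => S; rewrite !inE; case: (boolP (v \in S)) => vS /=.
    apply/esym/negP => /and3P[/subsetP/(_ v vS) vl' _ _].
    by rewrite vl' in vl.
  congr (_ && _); apply/subsetP/subsetP => Sl x Sx; have := Sl x Sx.
    by rewrite inE => /predU1P[xv|//]; rewrite -xv Sx in vS.
  by rewrite inE => ->; rewrite orbT.
have inj : {in cliques_in [seq x <- l | e v x] m &, injective (fun S => v |: S)}.
  have vN S : S \in cliques_in [seq x <- l | e v x] m -> v \notin S.
    rewrite inE => /and3P[/subsetP Sl _ _]; apply/negP => /Sl.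
    by rewrite mem_filter (negPf vl) andbF.
  by move=> S1 S2 /vN v1 /vN v2 eqS; rewrite -(setU1K v1) eqS setU1K.
rewrite -(card_in_imset inj); apply: eq_card => S; rewrite !inE.
apply/andP/imsetP => [[/and3P[/subsetP Sl /eqP cS /cliqueP kS] vS]|[S']].
  exists (S :\ v); last by rewrite setD1K.
  rewrite inE; apply/and3P; split.
  - apply/subsetP => x; rewrite !inE => /andP[nxv Sx]; rewrite mem_filter kS 1?eq_sym //=.
    by have := Sl x Sx; rewrite inE (negPf nxv).
  - by have := cardsD1 v S; rewrite vS cS add1n => -[<-].
  by apply/cliqueP => x y; rewrite !inE => /andP[_ Sx] /andP[_ Sy]; exact: kS.
rewrite inE => /and3P[/subsetP Sl /eqP cS /cliqueP kS] ->.
have vS' : v \notin S' by apply/negP => /Sl; rewrite mem_filter (negPf vl) andbF.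
have evS x : x \in S' -> e v x by move=> /Sl; rewrite mem_filter => /andP[].
rewrite setU11 cardsU1 vS' cS eqxx; split=> //; apply/andP; split.
  apply/subsetP => x; rewrite !inE => /orP[-> //|/Sl].
  by rewrite mem_filter => /andP[_ ->]; rewrite orbT.
apply/cliqueP => x y; rewrite !inE => /orP[/eqP->|Sx] /orP[/eqP->|Sy] nxy.
- by rewrite eqxx in nxy.
- exact: evS.
- by rewrite sym_e evS.
- exact: kS.
Qed.

(** An ordered clique is an injection into its image, and each of the m-cliques is
    the image of m! injections.  This removes the order of the columns from the
    count of matrices. *)
Lemma card_ordered_cliques l m : uniq l -> {in l, forall x, ~~ e x x} ->
  #|[set f : {ffun 'I_m -> T} | [forall i, f i \in l] &&
      [forall i, forall j, (i != j) ==> e (f i) (f j)]]| =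
  m`! * count_cliques e m l.
Proof.
move=> ul irr; set A := [set f | _].
have AP f : f \in A -> (forall i, f i \in l) /\ (forall i j, i != j -> e (f i) (f j)).
  rewrite inE => /andP[/forallP fl /forallP fe]; split=> // i j nij.
  by have /forallP/(_ j)/implyP := fe i; apply.
have Ainj f : f \in A -> injective f.
  move=> /AP[fl fe] i j eqf; apply/eqP/negPn/negP => /fe.
  by rewrite eqf (negPf (irr _ (fl j))).
pose h (f : {ffun 'I_m -> T}) := f @: 'I_m.
have hA f : f \in A -> h f \in cliques_in l m.
  move=> Af; have [fl fe] := AP f Af; rewrite inE; apply/and3P; split.
  - by apply/subsetP => x /imsetP[i _ ->].
  - by rewrite card_imset ?card_ord //; apply: Ainj.
  apply/cliqueP => x y /imsetP[i _ ->] /imsetP[j _ ->] nf; apply: fe.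
  by apply: contra nf => /eqP->.
rewrite -(card_cliques_in m ul) mulnC -sum1_card.
rewrite (partition_big h (mem (cliques_in l m))) //= -sum_nat_const.
apply: eq_bigr => S; rewrite inE => /and3P[/subsetP Sl /eqP cS /cliqueP kS].
have := card_inj_ffuns_on 'I_m (mem S); rewrite cS card_ord ffactnn => <-.
rewrite sum1dep_card; apply: eq_card => f; rewrite !inE.
apply/andP/andP => [[fA /eqP hS]|[/ffun_onP fS /injectiveP injf]].
  split; last by apply/injectiveP; apply: Ainj; rewrite inE.
  by apply/ffun_onP => i; rewrite -hS imset_f.
split.
  apply/andP; split; first by apply/forallP => i; apply/Sl/fS.
  apply/forallP => i; apply/forallP => j; apply/implyP => nij.
  by apply: kS => //; rewrite (inj_eq injf).
rewrite eqEcard cS card_imset // card_ord leqnn andbT.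
by apply/subsetP => x /imsetP[i _ ->].
Qed.

End Cliques.

(** * Positive definite matrices *)

Local Open Scope ring_scope.

Section PosDef.
Variable F : realFieldType.

Definition posdef n (A : 'M[F]_n) :=
  A^T = A /\ forall u : 'rV_n, u != 0 -> 0 < (u *m A *m u^T) 0 0.

(** Principal submatrices, inverses and Schur complements of positive definite
    matrices are all obtained by a congruence with injective B. *)
Lemma posdef_congr m n (A : 'M[F]_n) (B : 'M_(m, n)) :
  (forall u : 'rV_m, u *m B = 0 -> u = 0) -> posdef A ->
  posdef (B *m A *m B^T).
Proof.
move=> injB [symA posA]; split; first by rewrite !trmx_mul trmxK symA mulmxA.
move=> u nzu; have -> : u *m (B *m A *m B^T) *m u^T = (u *m B) *m A *m (u *m B)^T.
  by rewrite trmx_mul !mulmxA.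
by apply: posA; apply: contra nzu => /eqP/injB ->.
Qed.

Lemma posdef1 n : posdef (1%:M : 'M[F]_n).
Proof.
split=> [|u nzu]; first exact: trmx1.
rewrite mulmx1 mxE; under eq_bigr do rewrite mxE -expr2.
have [i nzi] : exists i, u 0 i != 0.
  apply/existsP; apply: contraNT nzu => /existsPn u0.
  by apply/eqP/rowP => i; rewrite mxE; apply/eqP; have := u0 i; rewrite negbK.
rewrite (bigD1 i) //= ltr_pwDl ?sumr_ge0 // => [|j _]; last exact: sqr_ge0.
by rewrite lt_def sqr_ge0 sqrf_eq0 nzi.
Qed.

Lemma posdef_gram n (A : 'M[F]_n) : A \in unitmx -> posdef (A *m A^T).
Proof.
move=> Au; have := @posdef_congr _ _ 1%:M A _ (@posdef1 n).
rewrite mulmx1; apply=> u uA0.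
by rewrite -(mulmxK Au u) uA0 mul0mx.
Qed.

Lemma posdef_unit n (A : 'M[F]_n) : posdef A -> A \in unitmx.
Proof.
move=> [_ posA]; rewrite -row_free_unit -kermx_eq0.
apply/rowV0P => v /sub_kermxP vA0; apply/eqP; apply: contraT => /posA.
by rewrite vA0 mul0mx mxE ltxx.
Qed.

Lemma posdef_inv n (A : 'M[F]_n) : posdef A -> posdef (invmx A).
Proof.
move=> pdA; have Au := posdef_unit pdA; have [symA _] := pdA.
have -> : invmx A = invmx A *m A *m (invmx A)^T.
  by rewrite mulVmx // mul1mx trmx_inv symA.
apply: posdef_congr => // u uA0.
by rewrite -(mulmxKV Au u) uA0 mul0mx.
Qed.

Lemma posdef_mxsub m n (h : 'I_m -> 'I_n) (A : 'M[F]_n) :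
  injective h -> posdef A -> posdef (mxsub h h A).
Proof.
move=> injh pdA; pose B : 'M[F]_(m, n) := rowsub h 1%:M.
have BB1 : B *m B^T = 1%:M.
  rewrite /B trmx_mxsub trmx1 -mxsub_mul mulmx1.
  by apply/matrixP => i j; rewrite !mxE (inj_eq injh).
have -> : mxsub h h A = B *m A *m B^T.
  by rewrite trmx_mxsub trmx1 -rowsubE mulmx_colsub mulmx1 -mxsub_comp.
apply: posdef_congr => // u uB0.
by rewrite -(mulmx1 u) -BB1 mulmxA uB0 mul0mx.
Qed.

Lemma posdef_block0 p q (A : 'M[F]_p) (D : 'M[F]_q) :
  posdef (block_mx A 0 0 D) <-> posdef A /\ posdef D.
Proof.
split=> [pdG | [[symA posA] [symD posD]]].
  split.
    have -> : A = mxsub (@lshift p q) (@lshift p q) (block_mx A 0 0 D).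
      by apply/matrixP => i j; rewrite mxE block_mxEul.
    by apply: posdef_mxsub pdG; apply: lshift_inj.
  have -> : D = mxsub (@rshift p q) (@rshift p q) (block_mx A 0 0 D).
    by apply/matrixP => i j; rewrite mxE block_mxEdr.
  by apply: posdef_mxsub pdG; apply: rshift_inj.
split=> [|u]; first by rewrite tr_block_mx symA symD !trmx0.
rewrite -[u]hsubmxK; set a := lsubmx u; set b := rsubmx u => nzab.
rewrite mul_row_block !mulmx0 addr0 add0r tr_row_mx mul_row_col.
have [a0 | nza] := eqVneq a 0.
  have nzb : b != 0 by apply: contraNneq nzab => b0; rewrite a0 b0 row_mx0.
  by rewrite a0 !mul0mx add0r posD.
have [->|nzb] := eqVneq b 0; first by rewrite !mul0mx addr0 posA.
have -> (X Y : 'M[F]_1) : (X + Y) 0 0 = X 0 0 + Y 0 0 by rewrite mxE.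
by rewrite addr_gt0 ?posA ?posD.
Qed.

(** Block elimination with pivot D; [schur_ulE] is the same with pivot A.  Both are
    needed: [fischer1] eliminates the large block, [ehlich_bound_block] the corner. *)
Lemma schur_drE p q (A : 'M[F]_p) (B : 'M_(p, q)) (D : 'M_q) :
  D^T = D -> D \in unitmx ->
  let U := block_mx 1%:M (B *m invmx D) 0 1%:M in
  block_mx A B B^T D =
    U *m block_mx (A - B *m invmx D *m B^T) 0 0 D *m U^T.
Proof.
move=> symD Du /=.
rewrite tr_block_mx !trmx1 trmx0 trmx_mul trmx_inv symD.
rewrite !mulmx_block !mul1mx !mulmx1 !mul0mx !mulmx0 !addr0 !add0r.
by rewrite -!mulmxA mulVmx // mulmx1 (mulmxA D) mulmxV // mul1mx subrK.
Qed.

Lemma det_schur_dr p q (A : 'M[F]_p) (B : 'M_(p, q)) (D : 'M_q) :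
  D^T = D -> D \in unitmx ->
  \det (block_mx A B B^T D) = \det D * \det (A - B *m invmx D *m B^T).
Proof.
move=> symD Du; rewrite (schur_drE _ _ symD Du) !det_mulmx det_tr !det_ublock.
by rewrite !det1 !mul1r mulr1 mulrC.
Qed.

Lemma posdef_schur_dr p q (A : 'M[F]_p) (B : 'M_(p, q)) (D : 'M_q) :
  D^T = D -> D \in unitmx ->
  posdef (block_mx A B B^T D) <->
  posdef (A - B *m invmx D *m B^T) /\ posdef D.
Proof.
move=> symD Du; rewrite -posdef_block0; have := schur_drE A B symD Du.
set U := block_mx 1%:M _ _ _ => /= defG.
have Uu : U \in unitmx by rewrite unitmxE det_ublock !det1 mulr1 unitr1.
have injm W : W \in unitmx -> forall u : 'rV[F]_(p + q), u *m W = 0 -> u = 0.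
  by move=> Wu u uW0; rewrite -(mulmxK Wu u) uW0 mul0mx.
split=> [pdG|]; last by rewrite defG; apply/posdef_congr/injm.
have -> : block_mx (A - B *m invmx D *m B^T) 0 0 D =
          invmx U *m block_mx A B B^T D *m (invmx U)^T.
  by rewrite defG trmx_inv !mulmxA mulVmx // mul1mx mulmxK // unitmx_tr.
by apply: posdef_congr pdG; apply: injm; rewrite unitmx_inv.
Qed.

Lemma schur_ulE p q (A : 'M[F]_p) (B : 'M_(p, q)) (D : 'M_q) :
  A^T = A -> A \in unitmx ->
  let L := block_mx 1%:M 0 (B^T *m invmx A) 1%:M in
  block_mx A B B^T D =
    L *m block_mx A 0 0 (D - B^T *m invmx A *m B) *m L^T.
Proof.
move=> symA Au /=.
rewrite tr_block_mx !trmx1 trmx0 trmx_mul trmx_inv symA trmxK.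
rewrite !mulmx_block !mul1mx !mulmx1 !mul0mx !mulmx0 !addr0 !add0r.
by rewrite -!mulmxA mulVmx // mulmx1 (mulmxA A) mulmxV // mul1mx addrC subrK.
Qed.

Lemma det_schur_ul p q (A : 'M[F]_p) (B : 'M_(p, q)) (D : 'M_q) :
  A^T = A -> A \in unitmx ->
  \det (block_mx A B B^T D) = \det A * \det (D - B^T *m invmx A *m B).
Proof.
move=> symA Au; rewrite (schur_ulE _ _ symA Au) !det_mulmx det_tr !det_lblock.
by rewrite !det1 !mul1r mulr1.
Qed.

Lemma posdef_schur_ul p q (A : 'M[F]_p) (B : 'M_(p, q)) (D : 'M_q) :
  A^T = A -> A \in unitmx ->
  posdef (block_mx A B B^T D) <->
  posdef A /\ posdef (D - B^T *m invmx A *m B).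
Proof.
move=> symA Au; rewrite -posdef_block0; have := schur_ulE B D symA Au.
set U := block_mx 1%:M _ _ _ => /= defG.
have Uu : U \in unitmx by rewrite unitmxE det_lblock !det1 mulr1 unitr1.
have injm W : W \in unitmx -> forall u : 'rV[F]_(p + q), u *m W = 0 -> u = 0.
  by move=> Wu u uW0; rewrite -(mulmxK Wu u) uW0 mul0mx.
split=> [pdG|]; last by rewrite defG; apply/posdef_congr/injm.
have -> : block_mx A 0 0 (D - B^T *m invmx A *m B) =
          invmx U *m block_mx A B B^T D *m (invmx U)^T.
  by rewrite defG trmx_inv !mulmxA mulVmx // mul1mx mulmxK // unitmx_tr.
by apply: posdef_congr pdG; apply: injm; rewrite unitmx_inv.
Qed.

Lemma posdef_blockE p q (G : 'M[F]_(p + q)) : posdef G ->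
  G = block_mx (ulsubmx G) (ursubmx G) (ursubmx G)^T (drsubmx G).
Proof. by move=> [symG _]; rewrite trmx_ursub symG submxK. Qed.

Lemma posdef_ulsub p q (G : 'M[F]_(p + q)) : posdef G -> posdef (ulsubmx G).
Proof.
move=> pdG; have -> : ulsubmx G = mxsub (@lshift p q) (@lshift p q) G.
  by apply/matrixP => i j; rewrite !mxE.
exact/posdef_mxsub/pdG/lshift_inj.
Qed.

Lemma posdef_drsub p q (G : 'M[F]_(p + q)) : posdef G -> posdef (drsubmx G).
Proof.
move=> pdG; have -> : drsubmx G = mxsub (@rshift p q) (@rshift p q) G.
  by apply/matrixP => i j; rewrite !mxE.
exact/posdef_mxsub/pdG/rshift_inj.
Qed.

Lemma posdef_diag n (A : 'M[F]_n) i : posdef A -> 0 < A i i.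
Proof.
move=> [_ posA]; have := posA (delta_mx 0 i).
have -> : delta_mx 0 i *m A *m (delta_mx 0 i)^T = (A i i)%:M :> 'M_1.
  apply/matrixP => x y; rewrite !ord1 trmx_delta -rowE -colE !mxE.
  by rewrite ?eqxx ?mulr1n.
rewrite mxE eqxx mulr1n; apply; apply/eqP => /matrixP/(_ 0 i).
by rewrite !mxE !eqxx => /eqP; rewrite oner_eq0.
Qed.

Lemma posdef_11 (A : 'M[F]_1) : posdef A <-> 0 < A 0 0.
Proof.
split=> [|A_gt0]; first exact: posdef_diag.
rewrite [A]mx11_scalar; split=> [|u nzu]; first exact: tr_scalar_mx.
rewrite mul_mx_scalar -scalemxAl mxE mulr_gt0 //.
by have := (posdef1 1).2 u nzu; rewrite mulmx1.
Qed.

Lemma posdef_det_gt0 n (A : 'M[F]_n) : posdef A -> 0 < \det A.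
Proof.
elim: n A => [|n IHn]; first by move=> A _; rewrite det_mx00.
rewrite -[n.+1]/(1 + n)%N => A pdA.
have pda := posdef_ulsub pdA; have [[syma _] au] := (pda, posdef_unit pda).
have [symA _] := pdA; move: pdA.
rewrite -[A]submxK -[dlsubmx A]trmxK trmx_dlsub symA.
rewrite posdef_schur_ul // => -[_ pdS].
by rewrite det_schur_ul // mulr_gt0 ?IHn // det_mx11 posdef_diag.
Qed.

(** Eliminating D leaves the corner a - u D^-1 u^T, which is at most a, with
    equality only for u = 0 because D^-1 is positive definite. *)
Lemma fischer1 n (a : 'M[F]_1) (u : 'rV[F]_n) (D : 'M[F]_n) :
  posdef (block_mx a u u^T D) ->
  \det (block_mx a u u^T D) <= a 0 0 * \det D ?= iff (u == 0).
Proof.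
move=> pdG; have pdD : posdef D by have := posdef_drsub pdG; rewrite block_mxKdr.
have [[symD _] Du] := (pdD, posdef_unit pdD).
rewrite det_schur_dr // det_mx11 [a 0 0 * _]mulrC.
have D_gt0 := posdef_det_gt0 pdD; have [_ posV] := posdef_inv pdD.
have [->|nzu] := eqVneq u 0.
  by rewrite !mul0mx subr0; split=> //; rewrite eqxx.
have uVu := posV u nzu.
have lt : (a - u *m invmx D *m u^T) 0 0 < a 0 0.
  have -> (X Y : 'M[F]_1) : (X - Y) 0 0 = X 0 0 - Y 0 0 by rewrite !mxE.
  by rewrite ltrBlDr ltrDl.
by split; rewrite ?ler_pM2l ?ltW // lt_eqF // ltr_pM2l.
Qed.

End PosDef.

(** * Determinant bounds *)

Section Bounds.
Variable F : realFieldType.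

(** Induction on p.  The Schur complement S of the first diagonal entry is split
    by the induction hypothesis; its upper left block is the Schur complement of
    the upper left block of G, and [fischer1] applied to the first row and the
    last q rows shows that passing from the lower right block of S to that of G
    can only increase the determinant. *)
Lemma fischer p q (G : 'M[F]_(p + q)) : posdef G ->
  \det G <= \det (ulsubmx G) * \det (drsubmx G) ?= iff (ursubmx G == 0).
Proof.
elim: p G => [|p IHp].
  move=> G _; have -> : drsubmx G = G.
    by apply/matrixP => i j; rewrite !mxE; congr (G _ _); apply: val_inj.
  by rewrite det_mx00 mul1r flatmx0 eqxx; split; rewrite ?eqxx.
rewrite -[(p.+1 + q)%N]/(1 + (p + q))%N => G pdG.
set a := ulsubmx (G : 'M_(1 + (p + q))).
set u := ursubmx (G : 'M_(1 + (p + q))).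
set D := drsubmx (G : 'M_(1 + (p + q))).
have [symG _] := pdG.
have defG : G = block_mx a u u^T D by exact: (posdef_blockE (pdG : posdef G)).
have pda : posdef a by exact: posdef_ulsub pdG.
have [[syma _] au] := (pda, posdef_unit pda).
pose S := D - u^T *m invmx a *m u.
have pdS : posdef S.
  by have := pdG; rewrite defG posdef_schur_ul // => -[].
have detG : \det G = \det a * \det S by rewrite defG det_schur_ul.
have a_gt0 := posdef_det_gt0 pda.
have defUL : ulsubmx (G : 'M_(p.+1 + q)) =
    block_mx a (lsubmx u) (lsubmx u)^T (ulsubmx D) :> 'M_(1 + p).
  rewrite -[LHS](@submxK _ 1 p 1 p); congr (@block_mx _ 1 p 1 p _ _ _ _).
  - by apply/matrixP => i j; rewrite !mxE; congr (G _ _); apply: val_inj.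
  - by apply/matrixP => i j; rewrite !mxE; congr (G _ _); apply: val_inj.
  - apply/matrixP => i j; rewrite !mxE -[in LHS]symG mxE.
    by congr (G _ _); apply: val_inj.
  by apply/matrixP => i j; rewrite !mxE; congr (G _ _); apply: val_inj.
have defDR : drsubmx (G : 'M_(p.+1 + q)) = drsubmx D.
  by apply/matrixP => i j; rewrite !mxE; congr (G _ _); apply: val_inj.
have defUR : ursubmx (G : 'M_(p.+1 + q)) =
    col_mx (rsubmx u) (ursubmx D) :> 'M_(1 + p, q).
  rewrite -[LHS](@vsubmxK _ 1 p); congr (@col_mx _ 1 p _ _ _).
  - by apply/matrixP => i j; rewrite !mxE; congr (G _ _); apply: val_inj.
  by apply/matrixP => i j; rewrite !mxE; congr (G _ _); apply: val_inj.
have defuTu : u^T *m invmx a *m u = block_mx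
    ((lsubmx u)^T *m invmx a *m lsubmx u) ((lsubmx u)^T *m invmx a *m rsubmx u)
    ((rsubmx u)^T *m invmx a *m lsubmx u) ((rsubmx u)^T *m invmx a *m rsubmx u).
  by rewrite -{1 2}[u]hsubmxK tr_row_mx mul_col_mx mul_col_row.
have sub_block X1 X2 X3 X4 Y : Y - block_mx X1 X2 X3 X4 = block_mx
    (ulsubmx Y - X1) (ursubmx Y - X2) (dlsubmx Y - X3) (drsubmx Y - X4)
    :> 'M[F]_(p + q).
  by rewrite -{1}[Y]submxK opp_block_mx add_block_mx.
have ulS : ulsubmx S = ulsubmx D - (lsubmx u)^T *m invmx a *m lsubmx u.
  by rewrite /S defuTu sub_block block_mxKul.
have urS : ursubmx S = ursubmx D - (lsubmx u)^T *m invmx a *m rsubmx u.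
  by rewrite /S defuTu sub_block block_mxKur.
have drS : drsubmx S = drsubmx D - (rsubmx u)^T *m invmx a *m rsubmx u.
  by rewrite /S defuTu sub_block block_mxKdr.
have detUL : \det (ulsubmx (G : 'M_(p.+1 + q))) = \det a * \det (ulsubmx S).
  by rewrite defUL ulS; exact: (det_schur_ul (lsubmx u) (ulsubmx D) syma au).
have eq_ur : (ursubmx (G : 'M_(p.+1 + q)) == 0) =
    (rsubmx u == 0) && (ursubmx D == 0).
  by rewrite defUR; exact: (@col_mx_eq0 _ 1 p q).
rewrite detG detUL defDR eq_ur.
have pdb : posdef (block_mx a (rsubmx u) (rsubmx u)^T (drsubmx D)).
  rewrite posdef_schur_ul //; split=> //.
  by rewrite -drS; apply: posdef_drsub.
have := fischer1 pdb; rewrite det_schur_ul // -drS -det_mx11 => f1.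
have {f1} [le1 eq1] : \det (drsubmx S) <= \det (drsubmx D) ?= iff (rsubmx u == 0).
  split; first by rewrite -(ler_pM2l a_gt0) f1.
  by rewrite -(inj_eq (mulfI (lt0r_neq0 a_gt0))) f1.
have [le2 eq2] := IHp S pdS.
have ul_gt0 : 0 < \det (ulsubmx S) by apply/posdef_det_gt0/posdef_ulsub.
rewrite -mulrA; split.
  rewrite ler_pM2l //; apply: le_trans le2 _.
  by rewrite ler_pM2l.
rewrite (inj_eq (mulfI (lt0r_neq0 a_gt0))).
have [u0|nzu] := eqVneq (rsubmx u) 0.
  move: eq1 urS; rewrite u0 eqxx => /eqP eq1; rewrite -eq1 eq2 => ->.
  by rewrite mulmx0 subr0.
apply/lt_eqF/(le_lt_trans le2).
by rewrite ltr_pM2l // lt_neqAle eq1 le1 andbT; apply: contra nzu.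
Qed.

Lemma det_le_diag s r (G : 'M[F]_(s + r)) c : posdef G ->
  (forall i, G (lshift r i) (lshift r i) <= c) ->
  \det G <= c ^+ s * \det (drsubmx G).
Proof.
elim: s G => [|s IHs].
  move=> G _ _; have -> : drsubmx G = G.
    by apply/matrixP => i j; rewrite !mxE; congr (G _ _); apply: val_inj.
  by rewrite expr0 mul1r.
rewrite -[(s.+1 + r)%N]/(1 + (s + r))%N => G pdG le_c.
have a_le_c : G 0 0 <= c.
  by have := le_c 0; congr (G _ _ <= _); apply: val_inj.
have c_ge0 : 0 <= c := le_trans (ltW (posdef_diag 0 pdG)) a_le_c.
have defG := posdef_blockE (pdG : @posdef F (1 + (s + r)) G).
have pdD : posdef (drsubmx (G : 'M_(1 + (s + r)))) by exact: posdef_drsub.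
have := pdG; rewrite defG => /fischer1[+ _]; rewrite -defG => le1.
apply: le_trans le1 _.
have -> : ulsubmx (G : 'M_(1 + (s + r))) 0 0 = G 0 0.
  by rewrite !mxE; congr (G _ _); apply: val_inj.
apply: le_trans (ler_wpM2r (ltW (posdef_det_gt0 pdD)) a_le_c) _.
rewrite exprS -mulrA; apply: ler_wpM2l => //.
have -> : drsubmx (G : 'M_(s.+1 + r)) = drsubmx (drsubmx (G : 'M_(1 + (s + r)))).
  by apply/matrixP => i j; rewrite !mxE; congr (G _ _); apply: val_inj.
apply: IHs => // i; rewrite !mxE.
have := le_c (rshift 1 i); congr (G _ _ <= _); exact: val_inj.
Qed.

(** One row at a time.  Writing the first diagonal entry as c + e and expanding
    linearly, det G = c det G' + det T, where T has corner e.  If det T > 0 then T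
    is positive definite, because its complement G' is.  Eliminating the corner e
    then subtracts u_i^2 / e >= e from each remaining diagonal entry c + e, so
    [det_le_diag] bounds det T by c^s e det (D - g^T g / e), where g is the part of
    the first row u that faces D.  As D - g^T g / e is again positive definite, the
    bound mu is only required in that case, which restricts g strongly. *)
Lemma ehlich_bound_block s r (G : 'M[F]_(s + r)) (c e mu : F) :
  posdef G -> 0 < c -> 0 < e -> 0 <= mu ->
  (forall i, G (lshift r i) (lshift r i) = c + e) ->
  (forall i j, lshift r i != j -> e ^+ 2 <= G (lshift r i) j ^+ 2) ->
  (forall i, let g := row i (ursubmx G) in
     posdef (drsubmx G - e^-1 *: (g^T *m g)) ->
     e * \det (drsubmx G - e^-1 *: (g^T *m g)) <= mu) ->
  c * \det G <= c ^+ s * (c * \det (drsubmx G) + s%:R * mu).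
Proof.
move=> + c_gt0 e_gt0 mu_ge0; elim: s G => [|s IHs].
  move=> G _ _ _ _; have -> : drsubmx G = G.
    by apply/matrixP => i j; rewrite !mxE; congr (G _ _); apply: val_inj.
  by rewrite expr0 mul1r mul0r addr0.
rewrite -[(s.+1 + r)%N]/(1 + (s + r))%N => G pdG diagG offG lemu.
set u := ursubmx (G : 'M_(1 + (s + r))).
set D := drsubmx (G : 'M_(1 + (s + r))).
have G00 : ulsubmx (G : 'M_(1 + (s + r))) = (c + e)%:M.
  rewrite [LHS]mx11_scalar !mxE -(diagG 0); congr (G _ _)%:M; exact: val_inj.
have defG : G = block_mx (c + e)%:M u u^T D.
  by rewrite -G00; exact: (posdef_blockE (pdG : posdef G)).
have pdD : posdef D by exact: posdef_drsub pdG.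
have [[symD _] Du] := (pdD, posdef_unit pdD).
have D_gt0 := posdef_det_gt0 pdD.
have defDR : drsubmx (G : 'M_(s.+1 + r)) = drsubmx D.
  by apply/matrixP => i j; rewrite !mxE; congr (G _ _); apply: val_inj.
pose T := block_mx e%:M u u^T D.
have detG : \det G = c * \det D + \det T.
  rewrite defG !det_schur_dr // !det_mx11.
  have corner a : (a%:M - u *m invmx D *m u^T) 0 0 = a - (u *m invmx D *m u^T) 0 0.
    by rewrite [LHS]mxE !mxE eqxx mulr1n.
  by rewrite !corner; ring.
have detT : \det T <= c ^+ s * mu.
  have [T_le0 | T_gt0] := leP (\det T) 0.
    by apply: le_trans T_le0 _; rewrite mulr_ge0 // exprn_ge0 // ltW.
  have pdT : posdef T.
    rewrite posdef_schur_dr //; split=> //; apply/posdef_11.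
    by move: T_gt0; rewrite det_schur_dr // pmulr_rgt0 // det_mx11.
  have eu : (e%:M : 'M[F]_1) \in unitmx.
    by rewrite unitmxE det_scalar1 unitfE gt_eqF.
  move: pdT; rewrite posdef_schur_ul ?tr_scalar_mx // => -[_].
  rewrite /T det_schur_ul ?tr_scalar_mx // det_scalar1.
  rewrite invmx_scalar mul_mx_scalar -scalemxAl.
  set S := D - _ => pdS.
  have drS : drsubmx S =
      drsubmx D - e^-1 *: ((row 0 (ursubmx (G : 'M_(s.+1 + r))))^T *m
                           row 0 (ursubmx (G : 'M_(s.+1 + r)))).
    apply/matrixP => i j; rewrite !mxE !big_ord1 !mxE.
    by congr (_ - _ * (G _ _ * G _ _)); apply: val_inj.
  have le1 : \det S <= c ^+ s * \det (drsubmx S).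
    apply: det_le_diag pdS _ => i; rewrite !mxE big_ord1 !mxE.
    have -> : G (rshift 1 (lshift r i)) (rshift 1 (lshift r i)) = c + e.
      by rewrite -(diagG (rshift 1 i)); congr (G _ _); apply: val_inj.
    have le2 : e ^+ 2 <= G (lshift (s + r) 0) (rshift 1 (lshift r i)) ^+ 2.
      have := offG 0 (rshift 1 (lshift r i)) isT.
      by congr (_ <= G _ _ ^+ 2); apply: val_inj.
    by rewrite -addrA gerDl subr_le0 mulrC ler_pdivlMr.
  apply: le_trans (ler_wpM2l (ltW e_gt0) le1) _.
  rewrite mulrCA; apply: ler_wpM2l; first by rewrite exprn_ge0 // ltW.
  suff: posdef (drsubmx S) -> e * \det (drsubmx S) <= mu.
    by apply; apply: posdef_drsub.
  by rewrite drS -defDR; exact: (lemu 0).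
have leD : c * \det D <= c ^+ s * (c * \det (drsubmx D) + s%:R * mu).
  apply: IHs => // [i | i j nij | i].
  - by rewrite !mxE -(diagG (rshift 1 i)); congr (G _ _); apply: val_inj.
  - have nij' : lshift r (rshift 1 i) != rshift 1 j.
      by apply: contra nij => /eqP/(congr1 val)/= [eij]; apply/eqP/val_inj.
    have := offG (rshift 1 i) (rshift 1 j) nij'; rewrite !mxE.
    by congr (_ <= G _ _ ^+ 2); apply: val_inj.
  have := lemu (rshift 1 i); rewrite defDR.
  suff -> : row (rshift 1 i) (ursubmx (G : 'M_(s.+1 + r))) = row i (ursubmx D) by [].
  by apply/matrixP => x y; rewrite !mxE; congr (G _ _); apply: val_inj.
rewrite detG mulrDr defDR exprS -[s.+1]addn1 natrD.
have := ler_wpM2l (ltW c_gt0) leD; have := ler_wpM2l (ltW c_gt0) detT; nra.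
Qed.

(** The index map that lists the values of f, then those of g; it turns statements
    about block matrices into statements about arbitrary sets of rows. *)
Definition glue T p q (f : 'I_p -> T) (g : 'I_q -> T) (i : 'I_(p + q)) : T :=
  match split i with inl a => f a | inr b => g b end.

Lemma glue_lshift T p q (f : 'I_p -> T) (g : 'I_q -> T) i :
  glue f g (lshift q i) = f i.
Proof.
rewrite /glue; case: split_ordP => a /eqP;
by rewrite ?eq_lrshift ?(inj_eq (@lshift_inj _ _)) // => /eqP->.
Qed.

Lemma glue_rshift T p q (f : 'I_p -> T) (g : 'I_q -> T) i :
  glue f g (rshift p i) = g i.
Proof.
rewrite /glue; case: split_ordP => a /eqP;
by rewrite ?eq_rlshift ?(inj_eq (@rshift_inj _ _)) // => /eqP->.
Qed.

Lemma glue_inj (T : eqType) p q (f : 'I_p -> T) (g : 'I_q -> T) :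
  injective f -> injective g -> (forall i j, f i != g j) ->
  injective (glue f g).
Proof.
move=> injf injg fg i j; rewrite -[i]splitK -[j]splitK.
case: (split i) => a; case: (split j) => b; rewrite /= ?glue_lshift ?glue_rshift.
- by move/injf->.
- by move/eqP; rewrite (negPf (fg _ _)).
- by move/eqP; rewrite eq_sym (negPf (fg _ _)).
- by move/injg->.
Qed.

Lemma det_mxsub_inj (R : comPzRingType) m n (h : 'I_m -> 'I_n) (A : 'M[R]_n) :
  m = n -> injective h -> \det (mxsub h h A) = \det A.
Proof.
move=> eq_mn; case: n / eq_mn h A => h A injh.
have -> : mxsub h h A = row_perm (perm injh) (col_perm (perm injh) A).
  by apply/matrixP => i j; rewrite !mxE !permE.
rewrite row_permE col_permE !det_mulmx !det_perm odd_permV mulrCA.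
by rewrite -signr_addb addbb mulr1.
Qed.

Lemma mxsub_ext (R : Type) m n m' n' (f f' : 'I_m' -> 'I_m)
    (g g' : 'I_n' -> 'I_n) (A : 'M[R]_(m, n)) :
  f =1 f' -> g =1 g' -> mxsub f g A = mxsub f' g' A.
Proof. by move=> ff gg; apply/matrixP => i j; rewrite !mxE ff gg. Qed.

Lemma fischer_mxsub n p q (k1 : 'I_p -> 'I_n) (k2 : 'I_q -> 'I_n)
    (G : 'M[F]_n) :
  (p + q)%N = n -> injective k1 -> injective k2 ->
  (forall i j, k1 i != k2 j) -> posdef G ->
  \det G <= \det (mxsub k1 k1 G) * \det (mxsub k2 k2 G)
    ?= iff (mxsub k1 k2 G == 0).
Proof.
move=> pqn inj1 inj2 dis12 pdG; pose h := glue k1 k2.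
have injh : injective h by exact: glue_inj.
have := fischer (posdef_mxsub injh pdG).
rewrite (det_mxsub_inj _ pqn injh).
rewrite ulsubmxEsub ursubmxEsub drsubmxEsub -!mxsub_comp.
have e1 : h \o lshift q =1 k1 by move=> i; apply: glue_lshift.
have e2 : h \o @rshift p q =1 k2 by move=> i; apply: glue_rshift.
by rewrite (mxsub_ext _ e1 e1) (mxsub_ext _ e1 e2) (mxsub_ext _ e2 e2).
Qed.

(** [ehlich_bound_block] for the principal submatrix D on an arbitrary list of rows k. *)
Lemma ehlich_bound n r (k : 'I_r -> 'I_n) (G : 'M[F]_n) (c e mu : F) :
  injective k -> posdef G -> 0 < c -> 0 < e -> 0 <= mu ->
  (forall i, G i i = c + e) ->
  (forall i j, i != j -> e ^+ 2 <= G i j ^+ 2) ->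
  (forall x, (forall i, k i != x) ->
     let D := \matrix_(i, j) (G (k i) (k j) - G (k i) x * G (k j) x / e) in
     posdef D -> e * \det D <= mu) ->
  c * \det G <= c ^+ (n - r) * (c * \det (mxsub k k G) + (n - r)%:R * mu).
Proof.
move=> injk pdG c_gt0 e_gt0 mu_ge0 diagG offG lemu.
pose A := [predC codom k]; pose s := #|A|.
have sE : s = (n - r)%N.
  have := cardC (mem (codom k)); rewrite card_codom // !card_ord => <-.
  by rewrite addKn.
have rn : (s + r)%N = n.
  by rewrite sE subnK //; have := leq_card _ injk; rewrite !card_ord.
have vA (i : 'I_s) : forall j, k j != enum_val i.
  move=> j; have := enum_valP i; rewrite inE; apply: contra => /eqP <-.
  exact: codom_f.
pose h := glue (fun i : 'I_s => enum_val i) k.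
have injh : injective h.
  by apply: glue_inj => // [|i j]; [exact: enum_val_inj | rewrite eq_sym vA].
have pdH := posdef_mxsub injh pdG.
have e1 : h \o @lshift s r =1 (fun i : 'I_s => enum_val i).
  by move=> i; apply: glue_lshift.
have e2 : h \o @rshift s r =1 k by move=> i; apply: glue_rshift.
have [symG _] := pdG.
have := @ehlich_bound_block s r (mxsub h h G) c e mu pdH c_gt0 e_gt0 mu_ge0.
rewrite (det_mxsub_inj _ rn injh) drsubmxEsub ursubmxEsub -!mxsub_comp.
rewrite (mxsub_ext _ e1 e2) (mxsub_ext _ e2 e2) -sE; apply=> [i | i j nij | i].
- by rewrite mxE diagG.
- by rewrite mxE offG // (inj_eq injh).
move: (lemu _ (vA i)) => /=; set D1 := \matrix_(_, _) _.
set D2 := mxsub k k G - _; suff -> : D2 = D1 by [].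
apply/matrixP => x y; rewrite !mxE big_ord1 !mxE mulrC.
by rewrite -[in G (enum_val i) (k x)]symG -[in G (enum_val i) (k y)]symG !mxE.
Qed.

End Bounds.

(** * Sign matrices and their Gram matrices *)

(** A sum that reduces by computation, so that [laplace] unfolds to an explicit
    polynomial in small dimensions. *)
Definition nsum (R : pzRingType) n (F : nat -> R) : R :=
  foldr (fun j s => F j + s) 0 (iota 0 n).

Lemma nsumE (R : pzRingType) n (F : nat -> R) : nsum n F = \sum_(j < n) F j.
Proof. by rewrite -(big_mkord xpredT F) /index_iota subn0 unlock. Qed.

Fixpoint laplace (R : pzRingType) n (f : nat -> nat -> R) : R :=
  if n is n'.+1 then
    nsum n (fun j => f 0 j *
      ((-1) ^+ j * laplace n' (fun a b => f a.+1 (bump j b))))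
  else 1.

Lemma det_laplace (R : comPzRingType) n (f : nat -> nat -> R) :
  \det (\matrix_(i < n, j < n) f i j) = laplace n f.
Proof.
elim: n f => [|n IHn] f; first by rewrite det_mx00.
rewrite (expand_det_row _ ord0) /= nsumE; apply: eq_bigr => j _.
rewrite mxE /cofactor add0n -IHn; congr (_ * (_ * \det _)).
by apply/matrixP => a b; rewrite !mxE.
Qed.

Section Signs.

Definition sg (b : bool) : int := (-1) ^+ b.

Lemma sgE b : sg b = 1 - 2 * b%:Z.
Proof. by case: b. Qed.

Lemma sg_addb a b : sg (a (+) b) = sg a * sg b.
Proof. exact: signr_addb. Qed.

Lemma sgK b : sg b * sg b = 1.
Proof. by case: b. Qed.

Definition sgmx m n (C : 'M[bool]_(m, n)) : 'M[int]_(m, n) := map_mx sg C.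

Definition gram n (C : 'M[bool]_n) : 'M[int]_n := sgmx C *m (sgmx C)^T.

Lemma gramE n (C : 'M[bool]_n) i j :
  gram C i j = \sum_k sg (C i k) * sg (C j k).
Proof. by rewrite mxE; under eq_bigr do rewrite !mxE. Qed.

Lemma gram_diag n (C : 'M[bool]_n) i : gram C i i = n%:Z.
Proof.
rewrite gramE; under eq_bigr do rewrite sgK.
by rewrite sumr_const card_ord natz.
Qed.

Definition row_parity n (C : 'M[bool]_n) i : bool := odd (\sum_j (C i j : nat))%N.

(** From (-1)^a (-1)^b = 1 - 2 a - 2 b + 4 a b, summed over the columns. *)
Lemma gram_mod4 n (C : 'M[bool]_n) i j : exists z : int,
  gram C i j = n%:Z - 2 * ((row_parity C i)%:Z + (row_parity C j)%:Z) + 4 * z.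
Proof.
pose w i : nat := (\sum_j (C i j : nat))%N.
exists ((\sum_k (C i k && C j k : nat))%N%:Z - (w i)./2%:Z - (w j)./2%:Z).
have -> : gram C i j = n%:Z - 2 * (w i)%:Z - 2 * (w j)%:Z +
    4 * (\sum_k (C i k && C j k : nat))%N%:Z.
  have -> : n%:Z = \sum_(k < n) 1 by rewrite sumr_const card_ord natz.
  have sumZ (F : 'I_n -> nat) : (\sum_k F k)%N%:Z = \sum_k (F k)%:Z.
    by rewrite -natz natr_sum; apply: eq_bigr => k _; rewrite natz.
  rewrite gramE /w !sumZ !mulr_sumr.
  rewrite -!sumrB -big_split /=; apply: eq_bigr => k _.
  by rewrite !sgE; case: (C i k); case: (C j k).
rewrite /row_parity -/(w i) -/(w j).
by have := odd_double_half (w i); have := odd_double_half (w j); lia.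
Qed.

Lemma det_gram n (C : 'M[bool]_n) : \det (gram C) = \det (sgmx C) ^+ 2.
Proof. by rewrite det_mulmx det_tr expr2. Qed.

(** Positive definiteness is used over the field of rationals, where Schur
    complements exist. *)
Definition ratmx m n (A : 'M[int]_(m, n)) : 'M[rat]_(m, n) := map_mx intr A.

Lemma posdef_gram01 n (C : 'M[bool]_n) : \det (sgmx C) != 0 ->
  posdef (ratmx (gram C)).
Proof.
move=> nz; rewrite /ratmx map_mxM -map_trmx; apply: posdef_gram.
by rewrite unitmxE det_map_mx unitfE intr_eq0.
Qed.

End Signs.

(** * Gram matrices with a large determinant *)

(** The Gram matrices that can reach the maximum: up to the signs s, an entry only
    depends on whether it is diagonal and on which of its indices lie in P. *)
Definition pattern_gram n (phi : bool -> bool -> bool -> int) (P : {set 'I_n})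
    (s : {ffun 'I_n -> bool}) : 'M[int]_n :=
  \matrix_(i, j) (sg (s i) * sg (s j) * phi (i == j) (i \in P) (j \in P)).

(** 8 I + J, with t added to the entries between two distinct elements of P. *)
Definition pattern9 (t : int) (e a b : bool) : int :=
  if e then 9 else if a && b then 1 + t else 1.

(** Two diagonal blocks 8 I + 2 J, indexed by P and by its complement. *)
Definition pattern10 (e a b : bool) : int :=
  if e then 10 else if a == b then 2 else 0.

Lemma ratmx_det n (A : 'M[int]_n) : \det (ratmx A) = (\det A)%:~R.
Proof. exact: det_map_mx. Qed.

Lemma det_tnth r n (t : r.-tuple 'I_n) (H : 'M[int]_n) x :
  \det (mxsub (tnth t) (tnth t) H) = laplace r (fun i j => H (nth x t i) (nth x t j)).
Proof.
rewrite -det_laplace; congr (\det _).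
by apply/matrixP => i j; rewrite !mxE !(tnth_nth x).
Qed.

Lemma ratmx_posdef_sym n (H : 'M[int]_n) i j :
  posdef (ratmx H) -> H i j = H j i.
Proof.
by move=> [/matrixP/(_ j i)]; rewrite !mxE => /eqP; rewrite eqr_int => /eqP.
Qed.

Section Nine.

Variable H : 'M[int]_9.
Hypothesis pdH : posdef (ratmx H).
Hypothesis diagH : forall i, H i i = 9.
Hypothesis modH : forall i j, i != j -> exists z : int, H i j = 1 + 4 * z.
Hypothesis detH : (2 ^+ 8 * 56) ^+ 2 <= \det H.

Let symH i j : H i j = H j i.
Proof. exact: ratmx_posdef_sym. Qed.

(** If D - g^T g is positive definite, with g the part facing D of another row, then
    9 - g_i^2 > 0; as g_i is 1 mod 4, this forces g_i = 1.  Hence only the matrix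
    D - J is relevant for mu, and its determinant is d. *)
Lemma bound9 r (t : r.-tuple 'I_9) (x0 : 'I_9) (mu : int) : uniq t -> 0 <= mu ->
  (let d := laplace r (fun i j => H (nth x0 t i) (nth x0 t j) - 1) in
   0 < d -> d <= mu) ->
  8 * \det H <=
  8 ^+ (9 - r) * (8 * laplace r (fun i j => H (nth x0 t i) (nth x0 t j)) + (9 - r)%:R * mu).
Proof.
move=> /tuple_uniqP injt mu_ge0 lemu; rewrite -(ler_int rat) -(det_tnth t).
have cast1 (a : int) : (8 * a)%:~R = 8 * a%:~R :> rat by ring.
have cast2 (k a b : int) m :
  (k * (8 * a + m%:R * b))%:~R = k%:~R * (8 * a%:~R + m%:R * b%:~R) :> rat by ring.
rewrite cast1 cast2 rmorphXn /= rmorph_nat.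
rewrite -!ratmx_det /ratmx map_mxsub -/(ratmx H).
apply: (ehlich_bound (e := 1) injt pdH) => //.
- by rewrite ler0z.
- by move=> i; rewrite mxE diagH.
- move=> i j nij; rewrite mxE; have [z ->] := modH nij.
  rewrite -[_ ^+ 2]/(1 : rat) -!rmorphXn /= -[1]/(1%:~R : rat) ler_int; nia.
move=> x nx /= pdD; rewrite mul1r.
have H1 i : H (tnth t i) x = 1.
  have := posdef_diag i pdD; rewrite !mxE diagH divr1 -!rmorphM -rmorphB /= ltr0z.
  by have [z ->] := modH (nx i); nia.
set D := \matrix_(_, _) _ in pdD *.
pose f i j := H (nth x0 t i) (nth x0 t j) - 1.
have defD : D = ratmx (\matrix_(i < r, j < r) f i j).
  by apply/matrixP => i j; rewrite !mxE !H1 !(tnth_nth x0) divr1 mulr1 rmorphB.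
have := posdef_det_gt0 pdD.
by rewrite defD ratmx_det ler_int ltr0z (det_laplace r f); apply: lemu.
Qed.

(** The bound of [bound9] against (2^8 * 56)^2 = 8^6 * 784, with the common powers
    of 8 removed. *)
Lemma bound9_large r (t : r.+2.-tuple 'I_9) (x0 : 'I_9) (mu d L : int) :
  d = laplace r.+2 (fun i j => H (nth x0 t i) (nth x0 t j) - 1) ->
  L = laplace r.+2 (fun i j => H (nth x0 t i) (nth x0 t j)) ->
  uniq t -> (r <= 7)%N -> 0 <= mu -> (0 < d -> d <= mu) ->
  8 ^+ r * 784 <= 8 * L + (7 - r)%:R * mu.
Proof.
move=> -> -> ut r7 mu_ge0 lemu; have := bound9 ut mu_ge0 lemu.
have := detH; set L' := laplace _ _; set D := \det H.
rewrite -[(9 - r.+2)%N]/(7 - r)%N => D_ge le1.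
have {D_ge} le2 : 8 ^+ (7 - r) * (8 ^+ r * 784) <= 8 * D.
  rewrite mulrA -exprD subnK //.
  have -> : 8 ^+ 7 * 784 = 8 * (2 ^+ 8 * 56) ^+ 2 :> int by ring.
  by rewrite ler_pM2l.
by have := le_trans le2 le1; rewrite ler_pM2l // exprn_gt0.
Qed.

(** An entry a outside {1, -3, 5} has a^2 >= 49, while D - J has determinant
    64 - (a - 1)^2 <= 0; the bound is then far too small. *)
Lemma pair9 x y : x != y -> H x y = 1 \/ H x y = -3 \/ H x y = 5.
Proof.
move=> nxy; have ut : uniq [tuple x; y] by rewrite /= inE nxy.
have [z Hz] := modH nxy.
have := @bound9_large 0 [tuple x; y] x 0 (64 - 16 * z ^+ 2)
  (81 - (1 + 4 * z) ^+ 2).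
rewrite /laplace /nsum /= !diagH (symH y x) Hz => bnd.
have [|z_large] := boolP ((-1 <= z) && (z <= 1)); first by lia.
suff : 784 <= 8 * (81 - (1 + 4 * z) ^+ 2) by nia.
rewrite -[784]mul1r -[leRHS]addr0 -[0](mulr0 7%:R).
by apply: bnd ut isT isT _; [ring | ring | nia].
Qed.

(** D has two entries different from 1 in the row of x; in all 12 cases det (D - J) <= 256 and
    det D <= 576, but [bound9_large] would need det D >= 592. *)
Lemma triple9 x y z : uniq [:: x; y; z] -> H x y != 1 -> H x z != 1 -> False.
Proof.
move=> ut; have := ut; rewrite /= !inE => /and3P[/norP[nxy nxz] nyz _].
have := @bound9_large 1 [tuple x; y; z] x 256
  (512 + 2 * (H x y - 1) * (H x z - 1) * (H y z - 1)
    - 8 * ((H x y - 1) ^+ 2 + (H x z - 1) ^+ 2 + (H y z - 1) ^+ 2))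
  (729 + 2 * H x y * H x z * H y z
    - 9 * (H x y ^+ 2 + H x z ^+ 2 + H y z ^+ 2)).
rewrite /laplace /nsum /= !diagH (symH y x) (symH z x) (symH z y) => bnd nab nac.
have := bnd ltac:(ring) ltac:(ring) ut isT isT.
move: (pair9 nxy) (pair9 nxz) (pair9 nyz) nab nac; clear.
move: (H x y) (H x z) (H y z) => a b c ha hb hc na nb.
have {ha na} ha : a = -3 \/ a = 5 by lia.
have {hb nb} hb : b = -3 \/ b = 5 by lia.
by case: ha => ->; case: hb => ->; case: hc => [->|[->|->]]; lia.
Qed.

(** By [triple9] the four entries between {x, y} and {z, w} are 1.  Then
    det (D - J) <= 48^2 and det D <= 4608, but det D >= 4832 would be needed. *)
Lemma quad9 x y z w : uniq [:: x; y; z; w] -> H x y != 1 -> H z w != 1 -> False.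
Proof.
move=> ut nab ncd; have := ut; rewrite /= !inE.
move=> /and4P[/norP[nxy /norP[nxz nxw]] /norP[nyz nyw] nzw _].
have centre a b c : a != b -> b != c -> a != c -> H a b != 1 -> H a c = 1.
  move=> nab' nbc nac hab; apply/eqP/negPn/negP => hac.
  by apply: (@triple9 a b c) hab hac; rewrite /= !inE negb_or nab' nac nbc.
have xz1 : H x z = 1 by apply: centre nab.
have xw1 : H x w = 1 by apply: centre nab.
have yz1 : H y z = 1 by apply: (@centre y x z _ nxz nyz); [rewrite eq_sym | rewrite symH].
have yw1 : H y w = 1 by apply: (@centre y x w _ nxw nyw); [rewrite eq_sym | rewrite symH].
have := @bound9_large 2 [tuple x; y; z; w] x 2304
  ((64 - (H x y - 1) ^+ 2) * (64 - (H z w - 1) ^+ 2))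
  ((9 - H x y) * (9 - H z w) * ((9 + H x y) * (9 + H z w) - 4)).
rewrite /laplace /nsum /= !diagH (symH y x) (symH z x) (symH z y).
rewrite (symH w x) (symH w y) (symH w z) xz1 xw1 yz1 yw1 => bnd.
have := bnd ltac:(ring) ltac:(ring) ut isT isT.
move: (pair9 nxy) (pair9 nzw) nab ncd; clear.
move: (H x y) (H z w) => a b ha hb na nb.
have {ha na} ha : a = -3 \/ a = 5 by lia.
have {hb nb} hb : b = -3 \/ b = 5 by lia.
by case: ha => ->; case: hb => ->; lia.
Qed.

Lemma only9 x y i j : x != y -> i != j -> H x y != 1 -> H i j != 1 ->
  (i == x) && (j == y) || (i == y) && (j == x).
Proof.
move=> nxy nij hxy hij; have nyx : y != x by rewrite eq_sym.
have hyx : H y x != 1 by rewrite symH.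
have sq a b c : a != b -> a != c -> b != c -> uniq [:: a; b; c].
  by move=> ab ac bc; rewrite /= !inE negb_or ab ac bc.
have [ix|nix] := eqVneq i x.
  rewrite ix in nij hij *; have [//|njy] := eqVneq j y.
  by case: (@triple9 x y j) => //; apply: sq; rewrite // eq_sym.
have [iy|niy] := eqVneq i y.
  rewrite iy in nij hij *; have [//|njx] := eqVneq j x.
  by case: (@triple9 y x j) => //; apply: sq; rewrite // eq_sym.
have [jx|njx] := eqVneq j x.
  rewrite jx in nij hij *; case: (@triple9 x y i) => //; last by rewrite symH.
  by apply: sq; rewrite // eq_sym.
have [jy|njy] := eqVneq j y.
  rewrite jy in nij hij *; case: (@triple9 y x i) => //; last by rewrite symH.
  by apply: sq; rewrite // eq_sym.
case: (@quad9 x y i j) => //.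
by rewrite /= !inE !negb_or nxy nij !(eq_sym x) !(eq_sym y) nix njx niy njy.
Qed.

Lemma shape9 : exists (P : {set 'I_9}) (t : int),
  [/\ #|P| = 2%N, [\/ t = 0, t = - 4 | t = 4] &
     forall i j, H i j = pattern9 t (i == j) (i \in P) (j \in P)].
Proof.
have [[x [y [nxy nH1]]]|all1] : (exists x y, x != y /\ H x y != 1) \/
    (forall x y, x != y -> H x y = 1).
  have [/existsP[x /existsP[y /andP[nxy hxy]]]|/existsPn no] :=
    boolP [exists x, exists y, (x != y) && (H x y != 1)].
    by left; exists x, y.
  right=> x y nxy; have /existsPn/(_ y) := no x.
  by rewrite nxy negbK => /eqP.
- exists [set x; y], (H x y - 1); split.
  + by rewrite cards2 nxy.
  + by move: nH1; case: (pair9 nxy) => [->|[->|->]] // _; constructor.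
  move=> i j; rewrite /pattern9; have [->|nij] := eqVneq i j; first exact: diagH.
  rewrite !inE; case: ifPn => [/andP[/orP[]/eqP ei /orP[]/eqP ej]|nP].
  + by rewrite ei ej eqxx in nij.
  + by rewrite ei ej; ring.
  + by rewrite ei ej symH; ring.
  + by rewrite ei ej eqxx in nij.
  apply/eqP/negPn/negP => hij; move: nP.
  by have /orP[/andP[-> ->]|/andP[-> ->]] := only9 nxy nij nH1 hij; rewrite ?orbT.
exists [set ord0; ord_max], 0; split; first by rewrite cards2.
  by constructor.
move=> i j; rewrite /pattern9 addr0 if_same.
by have [->|nij] := eqVneq i j; [exact: diagH | exact: all1].
Qed.

End Nine.

Section Ten.

Lemma hadamard (F : realFieldType) n (A : 'M[F]_n) c : posdef A ->
  (forall i, A i i <= c) -> \det A <= c ^+ n.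
Proof.
move=> pdA lec; have n0 := addn0 n.
have injh : injective (cast_ord n0) by exact: cast_ord_inj.
have := @det_le_diag F n 0 _ c (posdef_mxsub injh pdA).
rewrite (det_mxsub_inj _ n0 injh) det_mx00 mulr1; apply=> i.
by rewrite mxE.
Qed.

Variables (n : nat) (H : 'M[int]_n).
Hypothesis pdH : posdef (ratmx H).
Hypothesis diagH : forall i, H i i = 10.
Hypothesis offH : forall i j, i != j -> 4 <= H i j ^+ 2.

(** For e = 2 a positive definite D - g^T g / 2 has diagonal entries
    10 - g_i^2 / 2 <= 8, so Hadamard's inequality alone provides mu. *)
Lemma bound10 r (t : r.-tuple 'I_n) (L : int) x0 :
  L = laplace r (fun i j => H (nth x0 t i) (nth x0 t j)) ->
  uniq t ->
  8 * \det H <= 8 ^+ (n - r) * (8 * L + (n - r)%:R * (2 * 8 ^+ r)).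
Proof.
move=> -> /tuple_uniqP injt; rewrite -(ler_int rat) -(det_tnth t).
have cast1 (a : int) : (8 * a)%:~R = 8 * a%:~R :> rat by ring.
have cast2 (k a b : int) m :
  (k * (8 * a + m%:R * (2 * b)))%:~R =
  k%:~R * (8 * a%:~R + m%:R * (2 * b%:~R)) :> rat by ring.
rewrite cast1 cast2 !rmorphXn /= rmorph_nat.
rewrite -!ratmx_det /ratmx map_mxsub -/(ratmx H).
apply: (ehlich_bound (e := 2) injt pdH) => //.
- by rewrite mulr_ge0 ?exprn_ge0.
- by move=> i; rewrite mxE diagH.
- move=> i j nij; rewrite mxE; have := offH nij.
  by rewrite -(ler_int rat) rmorphXn.
move=> x nx /= pdD; rewrite ler_pM2l //; apply: hadamard pdD _ => i.
rewrite !mxE diagH; have := offH (nx i); rewrite -(ler_int rat) rmorphXn /= expr2.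
by rewrite -[4%:~R]/(4 : rat) -[10%:~R]/(10 : rat); lra.
Qed.

End Ten.

Section Flip.

Definition rowflip m n (s : {ffun 'I_m -> bool}) (C : 'M[bool]_(m, n)) :
    'M[bool]_(m, n) :=
  \matrix_(i, j) (s i (+) C i j).

Lemma rowflipK m n s : involutive (@rowflip m n s).
Proof. by move=> C; apply/matrixP => i j; rewrite !mxE addKb. Qed.

Lemma gram_rowflip n s (C : 'M[bool]_n) i j :
  gram (rowflip s C) i j = sg (s i) * sg (s j) * gram C i j.
Proof.
rewrite !gramE mulr_sumr; apply: eq_bigr => k _.
by rewrite !mxE !sg_addb; ring.
Qed.

Lemma normr_prod_sg (I : finType) (F : I -> bool) : `|\prod_i sg (F i)| = 1.
Proof. by rewrite normr_prod big1 // => i _; case: (F i). Qed.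

Lemma det_rowflip n s (C : 'M[bool]_n) :
  `|\det (sgmx (rowflip s C))| = `|\det (sgmx C)|.
Proof.
have -> : sgmx (rowflip s C) = diag_mx (\row_i sg (s i)) *m sgmx C.
  by rewrite mul_diag_mx; apply/matrixP => i j; rewrite !mxE sg_addb.
rewrite det_mulmx det_diag normrM.
under eq_bigr do rewrite mxE.
by rewrite normr_prod_sg mul1r.
Qed.

End Flip.

(** Complementing the rows of odd parity makes all inner products 1 mod 4. *)
Lemma large_det9_pattern (C : 'M[bool]_9) : 2 ^+ 8 * 56 <= `|\det (sgmx C)| ->
  exists (P : {set 'I_9}) s (t : int),
  [/\ #|P| = 2%N, [\/ t = 0, t = - 4 | t = 4] & gram C = pattern_gram (pattern9 t) P s].
Proof.
pose s := [ffun i => row_parity C i]; pose D := rowflip s C.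
rewrite -(det_rowflip s) -/D => detD.
have detH : (2 ^+ 8 * 56) ^+ 2 <= \det (gram D).
  by rewrite det_gram -[leRHS]real_normK ?num_real // lerXn2r.
have [||||P [t [P2 t3 defD]]] := @shape9 (gram D); last 1 first.
- exists P, s, t; split=> //; apply/matrixP => i j.
  by rewrite [RHS]mxE -defD gram_rowflip mulrA mulrACA !sgK !mul1r.
- apply: posdef_gram01; rewrite -normr_gt0; apply: lt_le_trans detD.
  by rewrite mulr_gt0.
- by move=> i; rewrite gram_diag.
- move=> i j _; rewrite gram_rowflip !ffunE; have [z ->] := gram_mod4 C i j.
  rewrite !sgE; case: (row_parity C i); case: (row_parity C j) => /=.
  + by exists (z + 1); lia.
  + by exists (- z - 2); lia.
  + by exists (- z - 2); lia.
  by exists (z + 2); lia.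
exact: detH.
Qed.

Section Barba.

Variables (n : nat) (H : 'M[int]_n).
Hypothesis pdH : posdef (ratmx H).
Hypothesis diagH : forall i, H i i = 10.
Hypothesis modH : forall i j, i != j -> exists z : int, H i j = 2 + 4 * z.

Let offH i j : i != j -> 4 <= H i j ^+ 2.
Proof.
move=> /modH[z ->]; have zz : 0 <= z * (z + 1).
  have [z_ge0|z_lt0] := leP 0 z; first by rewrite mulr_ge0 //; lia.
  by rewrite -mulrNN mulr_ge0 //; lia.
have -> : (2 + 4 * z) ^+ 2 = 4 + 16 * (z * (z + 1)) by ring.
by lia.
Qed.

(** The case where D is empty. *)
Lemma barba : 8 * \det H <= 8 ^+ n * (8 + 2 * n%:Z).
Proof.
have [n0|] := posnP n.
  by move: H pdH; rewrite n0 => H0 _; rewrite det_mx00.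
case: n H pdH diagH offH => [//|m] H0 pd0 diag0 off0 _.
have := @bound10 m.+1 H0 pd0 diag0 off0 0 [tuple] 1 ord0 erefl isT.
by rewrite subn0 expr0 !mulr1 [m.+1%:R * _]mulrC -[m.+1%:Z]natz.
Qed.

Hypothesis n5 : n = 5%N.
Hypothesis detH : 8 ^+ 5 * 18 <= 8 * \det H.

(** An entry 2 mod 4 other than 2 and -2 has square at least 36; keeping it in D
    makes the bound strict. *)
Lemma barba5_pair x y : x != y -> H x y ^+ 2 = 4.
Proof.
move=> nxy; have ut : uniq [tuple x; y] by rewrite /= inE nxy.
have sym : H y x = H x y by exact: ratmx_posdef_sym.
have := @bound10 n H pdH diagH offH 2 [tuple x; y] (100 - H x y ^+ 2) x.
rewrite /laplace /nsum /= !diagH sym => bnd.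
have e3 : (n - 2 = 3)%N by rewrite n5.
have := bnd ltac:(ring) ut; rewrite e3 => /(le_trans detH).
have -> : 8 ^+ 5 * 18 = 8 ^+ 3 * 1152 :> int by ring.
rewrite ler_pM2l // => {bnd}; have [z ->] := modH nxy.
have -> : 3%:R * (2 * 8 ^+ 2) = 384 :> int by [].
nia.
Qed.

(** The three entries are 2 or -2.  If their product were -8 then det D = 864, and
    keeping them in D would make the bound strict. *)
Lemma barba5_triple x y z : uniq [:: x; y; z] -> H x y * H x z * H y z = 8.
Proof.
move=> ut; have := ut; rewrite /= !inE => /and3P[/norP[nxy nxz] nyz _].
have [sxy sxz syz] : [/\ H y x = H x y, H z x = H x z & H z y = H y z].
  by split; exact: ratmx_posdef_sym.
have := @bound10 n H pdH diagH offH 3 [tuple x; y; z] (1000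
  + 2 * (H x y * H x z * H y z) - 10 * (H x y ^+ 2 + H x z ^+ 2 + H y z ^+ 2)) x.
rewrite /laplace /nsum /= !diagH sxy sxz syz => bnd.
have e2 : (n - 3 = 2)%N by rewrite n5.
have := bnd ltac:(ring) ut; rewrite e2 => /(le_trans detH).
have -> : 8 ^+ 5 * 18 = 8 ^+ 2 * 9216 :> int by ring.
rewrite ler_pM2l // => {bnd}.
have -> : 2%:R * (2 * 8 ^+ 3) = 2048 :> int by [].
move: (barba5_pair nxy) (barba5_pair nxz) (barba5_pair nyz); clear.
move: (H x y) (H x z) (H y z) => a b c ha hb hc.
have {} ha : a = 2 \/ a = -2 by nia.
have {} hb : b = 2 \/ b = -2 by nia.
have {} hc : c = 2 \/ c = -2 by nia.
by case: ha => ->; case: hb => ->; case: hc => ->; lia.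
Qed.

End Barba.

Section TwoBlocks.

Variables (n : nat) (H : 'M[int]_n).
Hypothesis pdH : posdef (ratmx H).
Hypothesis diagH : forall i, H i i = 10.

Definition block_of (B : {set 'I_n}) : 'M[int]_#|B| :=
  mxsub (fun i : 'I_#|B| => enum_val i) (fun i : 'I_#|B| => enum_val i) H.

Lemma posdef_block_of B : posdef (ratmx (block_of B)).
Proof. by rewrite /ratmx map_mxsub; apply/posdef_mxsub/pdH/enum_val_inj. Qed.

Lemma block_of_diag B i : block_of B i i = 10.
Proof. by rewrite mxE. Qed.

(** By [barba5_pair] and [barba5_triple] the entries of an extremal block are 2 or
    -2 with all triple products positive, so the signs of the entries in the column
    of a fixed b determine all the others. *)
Lemma block_of_sign (B : {set 'I_n}) b :
  (forall i j, i \in B -> j \in B -> i != j -> exists z : int, H i j = 2 + 4 * z) ->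
  #|B| = 5%N -> 8 ^+ 5 * 18 <= 8 * \det (block_of B) -> b \in B ->
  forall i j, i \in B -> j \in B ->
  H i j = sg (H i b < 0) * sg (H j b < 0) * (if i == j then 10 else 2).
Proof.
move=> modH B5 detB Bb i j Bi Bj.
have modB x y : x != y -> exists z : int, block_of B x y = 2 + 4 * z.
  move=> nxy; rewrite mxE; apply: modH; rewrite ?enum_valP //.
  by rewrite (inj_eq enum_val_inj).
have pdB := posdef_block_of B.
have pairB x y : x \in B -> y \in B -> x != y -> H x y ^+ 2 = 4.
  move=> Bx By nxy.
  have := @barba5_pair _ _ pdB (@block_of_diag B) modB B5 detB
    (enum_rank_in Bx x) (enum_rank_in By y).
  rewrite mxE !enum_rankK_in //; apply; apply: contra nxy => /eqP/(congr1 enum_val).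
  by rewrite !enum_rankK_in // => ->.
have tripB x y z : x \in B -> y \in B -> z \in B -> uniq [:: x; y; z] ->
    H x y * H x z * H y z = 8.
  move=> Bx By Bz uxyz.
  have := @barba5_triple _ _ pdB (@block_of_diag B) modB B5 detB
    (enum_rank_in Bx x) (enum_rank_in Bx y) (enum_rank_in Bx z).
  rewrite !mxE !enum_rankK_in //; apply.
  rewrite -(map_inj_uniq enum_val_inj) /= !enum_rankK_in //.
have sym x y : H x y = H y x by exact: ratmx_posdef_sym.
have [->|nij] := eqVneq i j; first by rewrite sgK mul1r diagH.
have val2 x y : x \in B -> y \in B -> x != y -> H x y = 2 \/ H x y = - 2.
  by move=> Bx By /(pairB x y Bx By); nia.
have [ib|nib] := eqVneq i b.
  rewrite ib in nij *; rewrite diagH (sym j b).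
  by case: (val2 b j Bb Bj nij) => ->.
have [jb|njb] := eqVneq j b.
  by rewrite jb diagH; rewrite jb in nij; case: (val2 i b Bi Bb nij) => ->.
have := tripB i j b Bi Bj Bb; rewrite /= !inE negb_or nij nib njb => /(_ isT).
case: (val2 i b Bi Bb nib) => ->; case: (val2 j b Bj Bb njb) => -> /=;
by case: (val2 i j Bi Bj nij) => ->.
Qed.

End TwoBlocks.

(** With p rows of one parity and q = 10 - p of the other, Fischer's and Barba's
    inequalities give 64 det G <= 8^10 (8 + 2 p) (8 + 2 q) <= 8^10 * 18^2.  Equality
    throughout forces p = q = 5, two extremal blocks, and zeros between them. *)
Lemma large_det10_pattern (C : 'M[bool]_10) : 2 ^+ 9 * 144 <= `|\det (sgmx C)| ->
  exists (P : {set 'I_10}) s, #|P| = 5%N /\ gram C = pattern_gram pattern10 P s.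
Proof.
move=> detC; set H := gram C; set A := [set i | row_parity C i].
have pdH : posdef (ratmx H).
  apply: posdef_gram01; rewrite -normr_gt0; apply: lt_le_trans detC.
  by rewrite mulr_gt0 ?exprn_gt0.
have diagH i : H i i = 10 by exact: gram_diag.
have detH : 8 ^+ 10 * 324 <= 64 * \det H.
  have -> : 8 ^+ 10 * 324 = 64 * (2 ^+ 9 * 144) ^+ 2 :> int by ring.
  by rewrite ler_pM2l // det_gram -[leRHS]real_normK ?num_real // lerXn2r.
have modA (B : {set 'I_10}) : B = A \/ B = ~: A ->
    forall i j, i \in B -> j \in B -> i != j -> exists z : int, H i j = 2 + 4 * z.
  move=> AB i j Bi Bj _; have [z ->] := gram_mod4 C i j.
  have -> : row_parity C j = row_parity C i.
    by case: AB Bi Bj => ->; rewrite !inE; case: row_parity; case: row_parity.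
  case: row_parity; first by exists (z + 1); lia.
  by exists (z + 2); lia.
have barbaB (B : {set 'I_10}) : B = A \/ B = ~: A ->
    8 * \det (block_of H B) <= 8 ^+ #|B| * (8 + 2 * #|B|%:Z).
  move=> AB; apply: (@barba _ _ (posdef_block_of pdH B)) => [i|i j nij].
    exact: block_of_diag.
  rewrite mxE; apply: (modA B AB); rewrite ?enum_valP //.
  by rewrite (inj_eq enum_val_inj).
have [leA leC] := (barbaB A (or_introl erefl), barbaB (~: A) (or_intror erefl)).
have detB_gt0 B : 0 < \det (block_of H B).
  by have := posdef_det_gt0 (posdef_block_of pdH B); rewrite ratmx_det ltr0z.
have [fisch fisch_eq] : \det H <= \det (block_of H A) * \det (block_of H (~: A))
    ?= iff (mxsub (fun i : 'I_#|A| => enum_val i)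
              (fun i : 'I_#|~: A| => enum_val i) H == 0).
  have pq : (#|A| + #|~: A|)%N = 10%N by rewrite cardsC card_ord.
  have dis (i : 'I_#|A|) (j : 'I_#|~: A|) : enum_val i != enum_val j.
    have := enum_valP j; rewrite inE; apply: contra => /eqP <-.
    exact: enum_valP.
  have := fischer_mxsub pq (@enum_val_inj _ _) (@enum_val_inj _ _) dis pdH.
  rewrite /ratmx -!map_mxsub !det_map_mx -intrM => -[].
  have e0 p q (M : 'M[int]_(p, q)) : (map_mx intr M == 0 :> 'M[rat]_(p, q)) = (M == 0).
    apply/eqP/eqP => [M0|->]; last exact: map_mx0.
    apply/matrixP => i j; move/matrixP/(_ i j)/eqP: M0.
    by rewrite !mxE intr_eq0 => /eqP.
  by rewrite ler_int eqr_int e0.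
move: leA leC fisch; have [A0 C0] := (detB_gt0 A, detB_gt0 (~: A)).
have AC : #|~: A| = (10 - #|A|)%N by rewrite cardsCs setCK card_ord.
have A10 : (#|A| <= 10)%N by have := max_card A; rewrite card_ord.
move=> leA leC leAC.
have leH : 8 ^+ 10 * 324 <= (8 * \det (block_of H A)) * (8 * \det (block_of H (~: A))).
  by apply: le_trans detH _; rewrite mulrACA (_ : 8 * 8 = 64) // ler_pM2l.
have A5 : #|A| = 5%N.
  have : 8 ^+ 10 * 324 <= 8 ^+ 10 * ((8 + 2 * #|A|%:Z) * (8 + 2 * #|~: A|%:Z)).
    apply: le_trans leH _.
    have -> : 8 ^+ 10 = 8 ^+ #|A| * 8 ^+ #|~: A| :> int by rewrite -exprD AC subnKC.
    by rewrite [leRHS]mulrACA; apply: ler_pM => //; rewrite ltW // pmulr_rgt0.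
  rewrite ler_pM2l ?exprn_gt0 // AC; nia.
have C5 : #|~: A| = 5%N by rewrite AC A5.
have [K_gt0 KK] : 0 < 8 ^+ 5 * 18 :> int /\
    8 ^+ 10 * 324 = (8 ^+ 5 * 18) * (8 ^+ 5 * 18) :> int.
  by split; [rewrite mulr_gt0 ?exprn_gt0 | ring].
have {}leA : 8 * \det (block_of H A) <= 8 ^+ 5 * 18.
  by apply: le_trans leA _; rewrite A5.
have {}leC : 8 * \det (block_of H (~: A)) <= 8 ^+ 5 * 18.
  by apply: le_trans leC _; rewrite C5.
rewrite KK in leH detH.
have [KA KC detAC] : [/\ 8 ^+ 5 * 18 <= 8 * \det (block_of H A),
    8 ^+ 5 * 18 <= 8 * \det (block_of H (~: A)) &
    \det (block_of H A) * \det (block_of H (~: A)) <= \det H].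
  move: K_gt0 leA leC leH detH A0 C0; clear; move: (8 ^+ 5 * 18) => K.
  move: (\det H) (\det _) (\det _) => d x y K_gt0 lex ley leK led x_gt0 y_gt0.
  have y8 : 0 < 8 * y by rewrite mulr_gt0.
  have x8 : 0 < 8 * x by rewrite mulr_gt0.
  split.
  - by rewrite -(ler_pM2r K_gt0); apply: le_trans leK _; rewrite ler_pM2l.
  - by rewrite -(ler_pM2l K_gt0); apply: le_trans leK _; rewrite ler_pM2r.
  rewrite -(@ler_pM2l _ 64) //; apply: le_trans led.
  rewrite (_ : 64 = 8 * 8) // -mulrACA.
  by apply: ler_pM; rewrite // ltW.
have cross : mxsub (fun i : 'I_#|A| => enum_val i)
    (fun i : 'I_#|~: A| => enum_val i) H = 0.
  by apply/eqP; rewrite -fisch_eq eq_le leAC detAC.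
have [a Aa] : exists a, a \in A by apply/card_gt0P; rewrite A5.
have [c Ac] : exists c, c \in ~: A by apply/card_gt0P; rewrite C5.
have cross0 i j : i \in A -> j \in ~: A -> H i j = 0.
  move=> Ai Aj; move/matrixP/(_ (enum_rank_in Ai i) (enum_rank_in Aj j)): cross.
  by rewrite !mxE !enum_rankK_in.
have signA := block_of_sign pdH diagH (modA A (or_introl erefl)) A5 KA Aa.
have signC := block_of_sign pdH diagH (modA (~: A) (or_intror erefl)) C5 KC Ac.
exists A, [ffun i => H i (if i \in A then a else c) < 0]; split; first exact: A5.
apply/matrixP => i j; rewrite [RHS]mxE !ffunE /pattern10.
have inC k : (k \in ~: A) = (k \notin A) by rewrite inE.
case: (boolP (i \in A)) => Ai; case: (boolP (j \in A)) => Aj; rewrite ?eqxx.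
- exact: signA.
- have -> : (i == j) = false by apply: contraNF Aj => /eqP <-.
  by rewrite mulr0 cross0 ?inC.
- have -> : (i == j) = false by apply: contraNF Ai => /eqP ->.
  by rewrite mulr0 (ratmx_posdef_sym _ _ pdH) cross0 ?inC.
by apply: signC; rewrite inC.
Qed.

(** * From 0/1 matrices to sign matrices *)

Lemma card_bij_set (T1 T2 : finType) (f : T1 -> T2) (Q : pred T2) :
  bijective f -> #|[set x | Q (f x)]| = #|[set y | Q y]|.
Proof.
case=> g fK gK; rewrite -(card_imset _ (can_inj fK)); congr #|pred_of_set _|.
apply/setP => y; rewrite inE; apply/imsetP/idP => [[x + ->]|Qy].
  by rewrite inE.
by exists (g y); rewrite ?inE gK.
Qed.

Section Normalize.

Definition colflip m n (c : {ffun 'I_n -> bool}) (C : 'M[bool]_(m, n)) :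
    'M[bool]_(m, n) :=
  \matrix_(i, j) (c j (+) C i j).

Lemma colflipE m n c (C : 'M[bool]_(m, n)) i j : colflip c C i j = c j (+) C i j.
Proof. exact: mxE. Qed.

Lemma rowflipE m n s (C : 'M[bool]_(m, n)) i j : rowflip s C i j = s i (+) C i j.
Proof. exact: mxE. Qed.

Lemma colflipK m n c : involutive (@colflip m n c).
Proof. by move=> C; apply/matrixP => i j; rewrite !mxE addKb. Qed.

Lemma gram_colflip n c (C : 'M[bool]_n) : gram (colflip c C) = gram C.
Proof.
apply/matrixP => i j; rewrite !gramE; apply: eq_bigr => k _.
by rewrite !mxE !sg_addb mulrACA sgK mul1r.
Qed.

Lemma det_colflip n c (C : 'M[bool]_n) :
  `|\det (sgmx (colflip c C))| = `|\det (sgmx C)|.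
Proof.
apply/eqP; rewrite -(@eqrXn2 _ 2) // !real_normK ?num_real //.
by rewrite -!det_gram gram_colflip.
Qed.

Definition border n (B : 'M[bool]_n) : 'M[bool]_(1 + n) :=
  block_mx (const_mx false) (const_mx false) (const_mx false) B.

Lemma det_border n (B : 'M[bool]_n) :
  \det (sgmx (border B)) = (- 2) ^+ n * \det (mx01 B).
Proof.
(* L subtracts the first row from all the others, which leaves -2 B below it. *)
pose L : 'M[int]_(1 + n) := block_mx 1%:M 0 (- const_mx 1) 1%:M.
have -> : \det (sgmx (border B)) = \det (L *m sgmx (border B)).
  by rewrite det_mulmx det_lblock !det1 !mul1r.
have -> : L *m sgmx (border B) =
    block_mx 1%:M (const_mx 1) 0 (- 2 *: mx01 B) :> 'M_(1 + n).
  rewrite /sgmx map_block_mx !map_const_mx mulmx_block !mul1mx !mul0mx !addr0.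
  congr block_mx; apply/matrixP => i j; rewrite !mxE ?big_ord1 ?mxE ?ord1 //.
  by rewrite sgE; case: (B i j).
by rewrite det_ublock det1 mul1r detZ.
Qed.

(** The first row of [border] is not flipped: flipping all rows has the same effect
    as flipping all columns. *)
Definition head_false n (r : {ffun 'I_n -> bool}) : {ffun 'I_n.+1 -> bool} :=
  [ffun i => if unlift ord0 i is Some i' then r i' else false].

Definition unnormalize n
    (x : {ffun 'I_n.+1 -> bool} * {ffun 'I_n -> bool} * 'M[bool]_n) :
    'M[bool]_n.+1 :=
  colflip x.1.1 (rowflip (head_false x.1.2) (border x.2)).

Definition normalize n (C : 'M[bool]_n.+1) :
    {ffun 'I_n.+1 -> bool} * {ffun 'I_n -> bool} * 'M[bool]_n :=
  let c := [ffun j => C ord0 j] in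
  let r := [ffun i => C ord0 ord0 (+) C (lift ord0 i) ord0] in
  (c, r, \matrix_(i, j) (r i (+) (c (lift ord0 j) (+) C (lift ord0 i) (lift ord0 j)))).

Lemma ord0_lshift n : ord0 = lshift n (0 : 'I_1) :> 'I_(1 + n).
Proof. exact: val_inj. Qed.

Lemma lift0_rshift n (i : 'I_n) : lift ord0 i = rshift 1 i.
Proof. exact: val_inj. Qed.

Lemma border0r n (B : 'M[bool]_n) j : border B ord0 j = false.
Proof.
by case: (unliftP ord0 j) => [j'|] ->;
  rewrite ?lift0_rshift !ord0_lshift /border ?block_mxEul ?block_mxEur mxE.
Qed.

Lemma border0l n (B : 'M[bool]_n) i : border B i ord0 = false.
Proof.
by case: (unliftP ord0 i) => [i'|] ->;
  rewrite ?lift0_rshift !ord0_lshift /border ?block_mxEul ?block_mxEdl mxE.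
Qed.

Lemma borderE n (B : 'M[bool]_n) i j : border B (lift ord0 i) (lift ord0 j) = B i j.
Proof. by rewrite !lift0_rshift /border block_mxEdr. Qed.

Lemma unnormalize_bij n : bijective (@unnormalize n).
Proof.
exists (@normalize n) => [[[c r] B]|C].
  rewrite /normalize /unnormalize /=.
  have Ec : [ffun j => colflip c (rowflip (head_false r) (border B)) ord0 j] = c.
    by apply/ffunP => j; rewrite !ffunE colflipE rowflipE ffunE unlift_none border0r !addbF.
  have Er : [ffun i : 'I_n => colflip c (rowflip (head_false r) (border B)) ord0 ord0 (+)
      colflip c (rowflip (head_false r) (border B)) (lift ord0 i) ord0] = r.
    apply/ffunP => i; rewrite !ffunE !colflipE !rowflipE !ffunE unlift_none liftK !border0l !addbF.
    by rewrite addKb.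
  rewrite Ec Er; congr (_, _, _); apply/matrixP => i j.
  by rewrite mxE colflipE rowflipE ffunE liftK borderE !addKb.
apply/matrixP => i j; rewrite colflipE rowflipE !ffunE /=.
case: (unliftP ord0 i) => [i'|] ->; last by rewrite border0r !addbF.
case: (unliftP ord0 j) => [j'|] ->.
  by rewrite borderE !mxE !ffunE !addKb.
by rewrite border0l ffunE addbF addKb.
Qed.

Lemma det_unnormalize n x :
  `|\det (sgmx (@unnormalize n x))| = 2 ^+ n * `|\det (mx01 x.2)|.
Proof.
by rewrite det_colflip det_rowflip det_border normrM normrX normrN.
Qed.

(** [unnormalize] parametrizes the sign matrices by column signs, the signs of all
    rows but the first, and a 0/1 matrix. *)
Lemma card_large_det n (d : int) :
  #|[set C : 'M[bool]_n.+1 | 2 ^+ n * d <= `|\det (sgmx C)|]| =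
  (2 ^ n.+1 * 2 ^ n * #|[set B : 'M[bool]_n | (d <= `|\det (mx01 B)|)%R]|)%N.
Proof.
rewrite -(card_bij_set _ (unnormalize_bij n)).
have -> : [set x | 2 ^+ n * d <= `|\det (sgmx (@unnormalize n x))|] =
    setX (setX [set: _] [set: _]) [set B : 'M[bool]_n | d <= `|\det (mx01 B)|].
  by apply/setP => x; rewrite !inE /= det_unnormalize ler_pM2l ?exprn_gt0.
by rewrite !cardsX !cardsT !card_ffun !card_bool !card_ord.
Qed.

(** Exchanging two rows is a bijection between the determinants d and -d. *)
Lemma card_abs_det n (d : int) : 0 < d ->
  (forall B : 'M[bool]_n.+2, \det (mx01 B) <= d) ->
  #|[set B : 'M[bool]_n.+2 | d <= `|\det (mx01 B)|]| =
  (2 * #|[set B : 'M[bool]_n.+2 | (\det (mx01 B) == d)%R]|)%N.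
Proof.
move=> d_gt0 maxd; pose sw := row_perm (tperm ord0 ord_max) : 'M[bool]_n.+2 -> _.
have swK : involutive sw.
  by move=> B; apply/matrixP => i j; rewrite !mxE tpermK.
have det_sw B : \det (mx01 (sw B)) = - \det (mx01 B).
  have -> : mx01 (sw B) = row_perm (tperm ord0 ord_max) (mx01 B).
    by apply/matrixP => i j; rewrite !mxE.
  by rewrite row_permE det_mulmx det_perm odd_tperm mulN1r.
have -> : [set B : 'M[bool]_n.+2 | d <= `|\det (mx01 B)|] =
    [set B | \det (mx01 B) == d] :|: [set B | \det (mx01 (sw B)) == d].
  apply/setP => B; rewrite !inE det_sw.
  have := maxd B; have := maxd (sw B); rewrite det_sw; lia.
rewrite cardsU (card_bij_set (fun B => \det (mx01 B) == d) (inv_bij swK)).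
rewrite (_ : _ :&: _ = set0) ?cards0 ?subn0 ?mul2n ?addnn //.
by apply/setP => B; rewrite !inE det_sw; lia.
Qed.

End Normalize.

(** * Counting by Gram matrices *)

Lemma exists_perm_set (T : finType) (A B : {set T}) : #|A| = #|B| ->
  exists s : {perm T}, forall x, (s x \in B) = (x \in A).
Proof.
move=> AB; have CAB : #|~: A| = #|~: B| by rewrite (cardsCs (~: A)) (cardsCs (~: B)) !setCK AB.
pose h x := if x \in A then nth x (enum B) (index x (enum A))
            else nth x (enum (~: B)) (index x (enum (~: A))).
have hA x : x \in A -> h x \in B.
  move=> Ax; rewrite /h Ax -mem_enum mem_nth // -cardE -AB cardE.
  by rewrite index_mem mem_enum.
have hC x : x \notin A -> h x \notin B.
  move=> Ax; rewrite /h (negPf Ax) -in_setC -mem_enum mem_nth // -cardE -CAB cardE.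
  by rewrite index_mem mem_enum inE.
have hB x : (h x \in B) = (x \in A).
  by case: (boolP (x \in A)) => Ax; [exact: hA | apply/negbTE/hC].
have index_inj (X Y : {set T}) x y : #|X| = #|Y| -> x \in X -> y \in X ->
    nth x (enum Y) (index x (enum X)) = nth y (enum Y) (index y (enum X)) -> x = y.
  move=> XY Xx Xy; have lt z : z \in X -> (index z (enum X) < size (enum Y))%N.
    by move=> Xz; rewrite -cardE -XY cardE index_mem mem_enum.
  rewrite (set_nth_default y) ?lt // => /eqP; rewrite nth_uniq ?lt ?enum_uniq //.
  move=> /eqP eqi; have xX : x \in enum X by rewrite mem_enum.
  have yX : y \in enum X by rewrite mem_enum.
  by rewrite -(nth_index x xX) eqi nth_index.
have injh : injective h.
  move=> x y eqh; have eqA : (x \in A) = (y \in A) by rewrite -!hB eqh.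
  move: eqh; rewrite /h -eqA; case: ifPn => Ax.
    by apply: (index_inj A B x y AB Ax); rewrite -eqA.
  have [Cx Cy] : x \in ~: A /\ y \in ~: A by rewrite !in_setC -eqA.
  exact: (index_inj (~: A) (~: B) x y CAB Cx Cy).
by exists (perm injh) => x; rewrite permE hB.
Qed.

Lemma sum_bool_card (I : finType) (P Q : pred I) :
  (\sum_(i | P i) (Q i : nat) = #|[set i | P i && Q i]|)%N.
Proof.
by rewrite -sum1dep_card big_mkcondr; apply: eq_bigr => i _; case: (Q i).
Qed.

Section PatternCount.

Variables (n : nat) (phi : bool -> bool -> bool -> int).
Implicit Types (P : {set 'I_n}) (s : {ffun 'I_n -> bool}).

(** A row permutation sigma that maps P to P0 and the row signs s carry the
    factorizations of one Gram matrix of the family to those of another. *)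
Lemma pattern_gram_move P P0 s (sigma : {perm 'I_n}) (C : 'M[bool]_n) :
  (forall i, (sigma i \in P0) = (i \in P)) ->
  (gram (rowflip s (row_perm sigma C)) == pattern_gram phi P s) =
  (gram C == pattern_gram phi P0 [ffun=> false]).
Proof.
move=> sP.
have E i j : gram (rowflip s (row_perm sigma C)) i j =
    sg (s i) * sg (s j) * gram C (sigma i) (sigma j).
  rewrite gram_rowflip !gramE; congr (_ * _).
  by apply: eq_bigr => k _; rewrite !mxE.
have F i j : pattern_gram phi P s i j =
    sg (s i) * sg (s j) * pattern_gram phi P0 [ffun=> false] (sigma i) (sigma j).
  by rewrite !mxE !ffunE !mul1r !sP (inj_eq perm_inj).
apply/eqP/eqP => [eqG|eqG]; last by apply/matrixP => i j; rewrite E F eqG.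
apply/matrixP => i j; have := E (sigma^-1 i)%g (sigma^-1 j)%g.
rewrite eqG F !permKV => /mulfI -> //.
by case: (s _); case: (s _).
Qed.

Lemma det_row_perm_sg (sigma : {perm 'I_n}) (C : 'M[bool]_n) :
  `|\det (sgmx (row_perm sigma C))| = `|\det (sgmx C)|.
Proof.
have -> : sgmx (row_perm sigma C) = row_perm sigma (sgmx C).
  by apply/matrixP => i j; rewrite !mxE.
by rewrite row_permE det_mulmx det_perm normrM normr_sign mul1r.
Qed.

Lemma card_pattern_gram P P0 s : #|P| = #|P0| ->
  #|[set C | gram C == pattern_gram phi P s]| =
  #|[set C | gram C == pattern_gram phi P0 [ffun=> false]]|.
Proof.
case/exists_perm_set => sigma sP; pose f (C : 'M[bool]_n) := rowflip s (row_perm sigma C).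
have fbij : bijective f.
  exists (fun C => row_perm sigma^-1 (rowflip s C)) => C; rewrite /f.
    by rewrite rowflipK -row_permM mulVg row_perm1.
  by rewrite -row_permM mulgV row_perm1 rowflipK.
rewrite -(card_bij_set (fun C => gram C == pattern_gram phi P s) fbij).
by apply: eq_card => C; rewrite !inE (pattern_gram_move _ _ sP).
Qed.

Lemma det_pattern_gram P P0 s (C : 'M[bool]_n) : #|P| = #|P0| ->
  gram C = pattern_gram phi P s ->
  `|\det (sgmx C)| ^+ 2 = \det (pattern_gram phi P0 [ffun=> false]).
Proof.
case/exists_perm_set => sigma sP eqC.
pose C0 := row_perm sigma^-1 (rowflip s C).
have defC : C = rowflip s (row_perm sigma C0).
  by rewrite /C0 -row_permM mulgV row_perm1 rowflipK.
have /eqP <- : gram C0 == pattern_gram phi P0 [ffun=> false].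
  by rewrite -(pattern_gram_move s _ sP) -defC eqC.
by rewrite det_gram /C0 -[RHS]real_normK ?num_real // det_row_perm_sg det_rowflip.
Qed.

(** Counts the pairs (C, (P, s)) with C C^T equal to the pattern matrix of (P, s):
    every C with a large determinant lies in t pairs, and every (P, s) in as many
    pairs as (P0, all signs positive). *)
Lemma double_count (P0 : {set 'I_n}) (d : int) (t : nat) :
  0 < d ->
  (forall C : 'M[bool]_n, d <= `|\det (sgmx C)| ->
     exists P s, #|P| = #|P0| /\ gram C = pattern_gram phi P s) ->
  \det (pattern_gram phi P0 [ffun=> false]) = d ^+ 2 ->
  (forall P s, #|P| = #|P0| ->
     #|[set x : {set 'I_n} * {ffun 'I_n -> bool} |
         (#|x.1| == #|P0|) && (pattern_gram phi x.1 x.2 == pattern_gram phi P s)]| = t) ->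
  (#|[set C : 'M[bool]_n | (d <= `|\det (sgmx C)|)%R]| * t =
  'C(n, #|P0|) * 2 ^ n * #|[set C | gram C == pattern_gram phi P0 [ffun=> false]]|)%N.
Proof.
move=> d_gt0 struct detP0 tors.
pose X := [set x : {set 'I_n} * {ffun 'I_n -> bool} | #|x.1| == #|P0|].
pose R (C : 'M[bool]_n) (x : {set 'I_n} * {ffun 'I_n -> bool}) : bool :=
  gram C == pattern_gram phi x.1 x.2.
have norm2 P s C : #|P| = #|P0| -> gram C = pattern_gram phi P s -> d <= `|\det (sgmx C)|.
  move=> PP0 /(det_pattern_gram PP0); rewrite detP0 => /eqP.
  by rewrite eqrXn2 ?normr_ge0 ?(ltW d_gt0) // => /eqP ->.
transitivity (\sum_(C : 'M[bool]_n | (d <= `|\det (sgmx C)|)%R) \sum_(x in X) (R C x : nat))%N.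
  rewrite -sum1dep_card big_distrl /=; apply: eq_bigr => C dC.
  have [P [s [PP0 eqC]]] := struct C dC; rewrite mul1n -(tors P s PP0).
  rewrite sum_bool_card; apply: eq_card => x.
  by rewrite !inE /R eqC (eq_sym (pattern_gram phi P s)).
rewrite exchange_big /=.
have -> : ('C(n, #|P0|) * 2 ^ n = #|X|)%N.
  have -> : X = setX [set P : {set 'I_n} | #|P| == #|P0|] [set: _].
    by apply/setP => x; rewrite !inE andbT.
  by rewrite cardsX card_draws cardsT card_ffun card_bool !card_ord.
rewrite -sum1_card big_distrl /=; apply: eq_bigr => -[P s]; rewrite inE /= => /eqP PP0.
rewrite mul1n -(card_pattern_gram s PP0) sum_bool_card; apply: eq_card => C.
rewrite !inE /R /=.
by have [/(norm2 _ _ _ PP0) -> //|_] := eqVneq (gram C) _; rewrite andbF.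
Qed.

End PatternCount.

(** * Integer matrices given by functions into Z *)

Section ZMatrices.

Definition zsum n (f : nat -> Z) : Z := foldr (fun i s => Z.add (f i) s) Z0 (iota 0 n).
Definition zprod n (f : nat -> Z) : Z := foldr (fun i s => Z.mul (f i) s) (Zpos xH) (iota 0 n).

Lemma zsumE n f : int_of_Z (zsum n f) = \sum_(i < n) int_of_Z (f i).
Proof.
rewrite -(big_mkord xpredT (fun i => int_of_Z (f i))) /index_iota subn0 /zsum.
elim: (iota 0 n) => [|i s IHs]; first by rewrite big_nil.
by rewrite big_cons -IHs /= -rmorphD.
Qed.

Lemma zprodE n f : int_of_Z (zprod n f) = \prod_(i < n) int_of_Z (f i).
Proof.
rewrite -(big_mkord xpredT (fun i => int_of_Z (f i))) /index_iota subn0 /zprod.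
elim: (iota 0 n) => [|i s IHs]; first by rewrite big_nil.
by rewrite big_cons -IHs /= -rmorphM.
Qed.

Definition zmx n (f : nat -> nat -> Z) : 'M[int]_n := \matrix_(i, j) int_of_Z (f i j).

(** Matrices as functions from indices to binary integers: unlike matrices over int,
    their products can be evaluated. *)
Definition zmul n (f g : nat -> nat -> Z) (i j : nat) : Z :=
  zsum n (fun k => Z.mul (f i k) (g k j)).

Lemma zmul_mx n f g : zmx n f *m zmx n g = zmx n (zmul n f g).
Proof.
apply/matrixP => i j; rewrite !mxE zsumE; apply: eq_bigr => k _.
by rewrite !mxE -rmorphM.
Qed.

Definition forall_below n (P : nat -> bool) : bool := all P (iota 0 n).

Lemma forall_belowP n P : forall_below n P -> forall i, (i < n)%N -> P i.
Proof. by move=> /allP allP i ltin; apply: allP; rewrite mem_iota. Qed.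

Definition zforall n (P : nat -> nat -> bool) : bool :=
  forall_below n (fun i => forall_below n (P i)).

Lemma zforallP n P : zforall n P -> forall i j : 'I_n, P i j.
Proof.
by move=> allP i j; exact: (forall_belowP (forall_belowP allP (ltn_ord i))).
Qed.

Lemma int_of_Z_eq a b : Z.eqb a b -> int_of_Z a = int_of_Z b.
Proof. by move/Z.eqb_spec ->. Qed.

(** A certificate G V = L with V upper and L lower triangular; the diagonals of V
    and L determine det G. *)
Definition trig_cert n (g v : nat -> nat -> Z) (d : Z) : bool := [&&
  zforall n (fun i j => (j < i)%N ==> Z.eqb (v i j) 0) ,
  zforall n (fun i j => (i < j)%N ==> Z.eqb (zmul n g v i j) 0) ,
  ~~ Z.eqb (zprod n (fun i => v i i)) 0 &
  Z.eqb (zprod n (fun i => zmul n g v i i)) (Z.mul d (zprod n (fun i => v i i)))].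

Lemma det_zmx_trig n (g v : nat -> nat -> Z) (d : Z) :
  trig_cert n g v d -> \det (zmx n g) = int_of_Z d.
Proof.
case/and4P=> /zforallP upV /zforallP lowL nzV /int_of_Z_eq.
rewrite (rmorphM int_of_Z) /= !zprodE => eqd.
have nz : \prod_(i < n) int_of_Z (v i i) != 0.
  rewrite -(zprodE n (fun i => v i i)); apply: contra nzV; rewrite -[0](rmorph0 int_of_Z).
  by rewrite (inj_eq (can_inj int_of_ZK)) => /eqP ->.
apply: (mulIf nz); rewrite -eqd.
have detV : \det (zmx n v) = \prod_(i < n) int_of_Z (v i i).
  rewrite -det_tr det_trig; first by apply: eq_bigr => i _; rewrite !mxE.
  by apply/is_trig_mxP => i j ij; rewrite !mxE (int_of_Z_eq (implyP (upV j i) ij)).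
rewrite -detV -det_mulmx zmul_mx det_trig; first by apply: eq_bigr => i _; rewrite !mxE.
by apply/is_trig_mxP => i j ij; rewrite !mxE (int_of_Z_eq (implyP (lowL i j) ij)).
Qed.

End ZMatrices.

Section Columns.

Lemma mul_scalar_comm n (A B : 'M[int]_n) (k : int) :
  k != 0 -> A *m B = k%:M -> B *m A = k%:M.
Proof.
move=> nzk AB; have nzk' : k%:~R != 0 :> rat by rewrite intr_eq0.
have ratmx_inj : injective (@ratmx n n).
  move=> X Y /matrixP XY; apply/matrixP => i j; have := XY i j.
  by rewrite !mxE => /eqP; rewrite eqr_int => /eqP.
apply: ratmx_inj; rewrite /ratmx map_mxM map_scalar_mx.
have : (k%:~R^-1 *: ratmx A) *m ratmx B = 1%:M.
  rewrite -scalemxAl /ratmx -map_mxM AB map_scalar_mx scale_scalar_mx.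
  by rewrite mulVf.
move/mulmx1C; rewrite -scalemxAr => /(congr1 ( *:%R k%:~R)).
by rewrite scalerA mulfV // scale1r scale_scalar_mx mulr1.
Qed.

(** With K = k G^-1, the equation C C^T = G becomes C^T K C = k I, a condition on
    pairs of columns of C. *)
Lemma gram_eq n (G K : 'M[int]_n) (k : int) (C : 'M[bool]_n) :
  k != 0 -> K *m G = k%:M ->
  (gram C == G) = ((sgmx C)^T *m (K *m sgmx C) == k%:M).
Proof.
move=> nzk KG; apply/eqP/eqP => [GC|MKM].
  by apply: mul_scalar_comm => //; rewrite -mulmxA -/(gram C) GC.
have KMM : K *m gram C = k%:M.
  by rewrite /gram mulmxA; apply: mul_scalar_comm.
have GK : G *m K = k%:M by apply: mul_scalar_comm.
have : G *m (K *m gram C) = G *m (K *m G) by rewrite KMM KG.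
rewrite !(mulmxA G) GK !mul_scalar_mx => /matrixP eqk; apply/matrixP => i j.
have scaleE (X : 'M[int]_n) : (k *: X) i j = k * X i j by rewrite mxE.
by apply: (mulfI nzk); rewrite -!scaleE eqk.
Qed.

Variables (n : nat) (K : 'M[int]_n.+1).

Local Notation vec := {ffun 'I_n.+1 -> bool}.

Definition form (v w : vec) : int := \sum_i sg (v i) * \sum_j K i j * sg (w j).

Definition of_cols (f : {ffun 'I_n.+1 -> vec}) : 'M[bool]_n.+1 :=
  \matrix_(i, j) f j i.

Lemma of_cols_bij : bijective of_cols.
Proof.
exists (fun C : 'M_n.+1 => [ffun j => [ffun i => C i j]]) => [f|C].
  by apply/ffunP => j; apply/ffunP => i; rewrite !ffunE mxE.
by apply/matrixP => i j; rewrite mxE !ffunE.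
Qed.

Lemma form_cols f a b :
  ((sgmx (of_cols f))^T *m (K *m sgmx (of_cols f))) a b = form (f a) (f b).
Proof.
rewrite mxE; apply: eq_bigr => i _; rewrite !mxE; congr (_ * _).
by apply: eq_bigr => j _; rewrite !mxE.
Qed.

Hypothesis symK : K^T = K.

Lemma form_sym v w : form v w = form w v.
Proof.
rewrite /form; under eq_bigr do rewrite mulr_sumr.
rewrite exchange_big; apply: eq_bigr => j _; rewrite mulr_sumr.
by apply: eq_bigr => i _; rewrite -[in K i j]symK mxE; ring.
Qed.

Variables (G : 'M[int]_n.+1) (k : int).
Hypotheses (nzk : k != 0) (KG : K *m G = k%:M).

Definition vertex (v : vec) := ~~ v ord0 && (form v v == k).
Definition edge : rel vec := fun v w => form w v == 0.

Lemma edge_sym : symmetric edge.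
Proof. by move=> v w; rewrite /edge form_sym. Qed.

Lemma vertex_irr v : vertex v -> ~~ edge v v.
Proof. by move=> /andP[_ /eqP fv]; rewrite /edge fv. Qed.

Lemma gram_of_cols f : (gram (of_cols f) == G) =
  [forall i, form (f i) (f i) == k] &&
  [forall i, forall j, (i != j) ==> edge (f i) (f j)].
Proof.
rewrite (gram_eq _ nzk KG); apply/eqP/andP => [/matrixP MKM|[/forallP fv /forallP fe]].
  split; first by apply/forallP => i; rewrite -form_cols MKM mxE eqxx.
  apply/forallP => i; apply/forallP => j; apply/implyP => nij.
  by rewrite /edge -form_cols MKM mxE (eq_sym j) (negPf nij).
apply/matrixP => a b; rewrite form_cols mxE; have [->|nab] := eqVneq a b.
  exact/eqP.
rewrite mulr0n; have /forallP/(_ a)/implyP := fe b; rewrite eq_sym => /(_ nab).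
by move/eqP.
Qed.

(** Column signs do not change the Gram matrix; they are fixed by making the first
    row positive. *)
Lemma card_gram_row0 :
  #|[set C : 'M[bool]_n.+1 | gram C == G]| =
  (2 ^ n.+1 * #|[set C : 'M[bool]_n.+1 | (gram C == G) &&
     [forall j, ~~ C ord0 j]]|)%N.
Proof.
set X := [set C | _ && _].
pose f (x : vec * 'M[bool]_n.+1) := colflip x.1 x.2.
have row0 C : C \in X -> forall j, C ord0 j = false.
  by rewrite inE => /andP[_ /forallP C0] j; apply/negbTE.
have inj : {in setX setT X &, injective f}.
  move=> [c C] [c' C'] /setXP[_ XC] /setXP[_ XC'] eqf.
  have eqc : c = c'.
    apply/ffunP => j; have /matrixP/(_ ord0 j) := eqf.
    by rewrite !colflipE !row0 // !addbF.
  move: eqf; rewrite eqc => /(congr1 (colflip c')).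
  by rewrite /f /= !colflipK => ->.
have -> : #|[set C : 'M[bool]_n.+1 | gram C == G]| = #|f @: setX setT X|.
  apply: eq_card => C; rewrite inE; apply/idP/imsetP => [GC|[[c C'] + ->]].
    pose c : vec := [ffun j => C ord0 j].
    exists (c, colflip c C); last by rewrite /f /= colflipK.
    rewrite !inE /= gram_colflip GC; apply/forallP => j.
    by rewrite colflipE ffunE addbb.
  by rewrite !inE /f /= gram_colflip => /andP[].
rewrite card_in_imset // cardsX cardsT card_ffun card_bool card_ord.
by [].
Qed.

(** The columns of the solutions with positive first row are the vertices of an
    ordered clique. *)
Lemma card_gram_cliques (l : seq vec) : uniq l -> l =i vertex ->
  #|[set C : 'M[bool]_n.+1 | gram C == G]| =
  (2 ^ n.+1 * (n.+1`! * count_cliques edge n.+1 l))%N.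
Proof.
move=> ul lv; rewrite card_gram_row0; congr (_ * _)%N.
rewrite -(card_bij_set _ of_cols_bij).
rewrite -(card_ordered_cliques edge_sym n.+1 ul); last first.
  by move=> v; rewrite lv; apply: vertex_irr.
apply: eq_card => f; rewrite !inE gram_of_cols -andbA andbCA andbC.
congr (_ && _); apply/andP/forallP => [[/forallP fk /forallP f0] i|fl].
  rewrite lv; apply/andP; split; last exact: fk.
  by have := f0 i; rewrite mxE.
split; apply/forallP => i; have := fl i; rewrite lv => /andP[] //.
by rewrite mxE.
Qed.

End Columns.

Section Lists.

Fixpoint words n : seq (seq bool) :=
  if n is n'.+1 then
    let ws := words n' in map (cons false) ws ++ map (cons true) ws
  else [:: [::]].

Lemma mem_words n w : (w \in words n) = (size w == n).
Proof.
elim: n w => [|n IHn] w; first by rewrite inE; case: w.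
rewrite mem_cat; apply/orP/idP => [[]/mapP[w' + ->]|].
- by rewrite IHn.
- by rewrite IHn.
case: w => [//|b w]; rewrite eqSS -IHn => nw.
by case: b; [right | left]; apply: map_f.
Qed.

Lemma words_uniq n : uniq (words n).
Proof.
elim: n => //= n IHn; rewrite cat_uniq !map_inj_uniq ?IHn; try by move=> ? ? [].
by rewrite andbT; apply/hasPn => w /mapP[w1 _ ->]; apply/negP => /mapP[].
Qed.

(** The scalar product of the sign vector (-1)^w with k; missing entries of w count
    as false, so that [sgdotE] needs no assumption on lengths. *)
Fixpoint sgdot (w : seq bool) (k : seq Z) : Z :=
  if k is x :: k' then
    let r := sgdot (behead w) k' in
    if head false w then Z.sub r x else Z.add r x
  else Z0.

Lemma sgdotE w k : int_of_Z (sgdot w k) =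
  \sum_(i < size k) sg (nth false w i) * int_of_Z (nth Z0 k i).
Proof.
elim: k w => [|x k IHk] w; first by rewrite big_ord0.
rewrite big_ord_recl /= nth0 addrC.
have -> : \sum_(i < size k) sg (nth false w (bump 0 i)) * int_of_Z (nth Z0 k i) =
    int_of_Z (sgdot (behead w) k).
  by rewrite IHk; apply: eq_bigr => i _; rewrite nth_behead.
case: (head false w); rewrite ?mulN1r ?mul1r.
  by rewrite -(rmorphB int_of_Z).
by rewrite -(rmorphD int_of_Z).
Qed.

Variables (n : nat) (kf : nat -> nat -> Z).

Definition zrows : seq (seq Z) := mkseq (fun i => mkseq (kf i) n.+1) n.+1.

Definition apply_rows (rows : seq (seq Z)) (w : seq bool) : seq Z :=
  map (sgdot w) rows.

Definition vertex_words (rows : seq (seq Z)) (k : Z) : seq (seq bool) :=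
  filter (fun w => Z.eqb (sgdot w (apply_rows rows w)) k)
    (map (cons false) (words n)).

(** The product of K with v is computed once for all the tests against v. *)
Definition edge_words (rows : seq (seq Z)) (v : seq bool) : pred (seq bool) :=
  let kv := apply_rows rows v in fun w => Z.eqb (sgdot w kv) Z0.

Definition vec_of_word (w : seq bool) : {ffun 'I_n.+1 -> bool} :=
  [ffun i => nth false w (i : 'I_n.+1)].

Lemma form_words v w : form (zmx n.+1 kf) (vec_of_word v) (vec_of_word w) =
  int_of_Z (sgdot v (apply_rows zrows w)).
Proof.
rewrite sgdotE size_map size_mkseq; apply: eq_bigr => i _; rewrite ffunE; congr (_ * _).
rewrite (nth_map [::]) ?size_mkseq // nth_mkseq // sgdotE size_mkseq.
by apply: eq_bigr => j _; rewrite ffunE mxE nth_mkseq // mulrC.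
Qed.

Lemma Zeqb_int a b : Z.eqb a b = (int_of_Z a == int_of_Z b).
Proof.
rewrite (inj_eq (can_inj int_of_ZK)).
by apply/idP/eqP => [/Z.eqb_spec|->] //; apply/Z.eqb_spec.
Qed.

(** kf is symmetric and kf * gf = k I with k nonzero. *)
Definition inv_pair (gf : nat -> nat -> Z) (k : Z) : bool :=
  [&& ~~ Z.eqb k Z0,
      zforall n.+1 (fun i j => Z.eqb (kf i j) (kf j i)) &
      zforall n.+1 (fun i j => Z.eqb (zmul n.+1 kf gf i j) (if i == j then k else Z0))].

Lemma card_gram_words gf k : inv_pair gf k ->
  #|[set C : 'M[bool]_n.+1 | gram C == zmx n.+1 gf]| =
  (2 ^ n.+1 * (n.+1`! *
     count_cliques (edge_words zrows) n.+1 (vertex_words zrows k)))%N.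
Proof.
move=> /and3P[nzk /zforallP symk /zforallP kg].
have symK : (zmx n.+1 kf)^T = zmx n.+1 kf.
  by apply/matrixP => i j; rewrite !mxE (int_of_Z_eq (symk j i)).
have nzk' : int_of_Z k != 0 by rewrite Zeqb_int in nzk.
have KG : zmx n.+1 kf *m zmx n.+1 gf = (int_of_Z k)%:M.
  rewrite zmul_mx; apply/matrixP => i j; rewrite !mxE (int_of_Z_eq (kg i j)).
  rewrite -[(i : nat) == j]/(i == j); by case: (i == j).
have Einj : {in vertex_words zrows k &, injective vec_of_word}.
  have sz w : w \in vertex_words zrows k -> size w = n.+1.
    by rewrite mem_filter => /andP[_ /mapP[w' + ->]]; rewrite mem_words => /eqP /= ->.
  move=> v w /sz sv /sz sw /ffunP eqvw; apply: (@eq_from_nth _ false).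
    by rewrite sv sw.
  by move=> i; rewrite sv => ilt; have := eqvw (Ordinal ilt); rewrite !ffunE.
rewrite (@card_gram_cliques _ _ symK _ _ nzk' KG (map vec_of_word (vertex_words zrows k))).
- congr (_ * (_ * _))%N; apply: count_cliques_map => v w.
  by rewrite /edge form_words /edge_words Zeqb_int.
- rewrite (map_inj_in_uniq Einj) filter_uniq // map_inj_uniq ?words_uniq //.
  by move=> ? ? [].
move=> v; rewrite [RHS]/(vertex _ _ v); apply/mapP/andP => [[w + ->]|[v0 fv]].
  rewrite mem_filter Zeqb_int => /andP[fw /mapP[w' _ ew]].
  by rewrite ffunE ew /= -ew form_words.
pose w := mkseq (fun i => v (inord i)) n.+1.
have vw : v = vec_of_word w.
  by apply/ffunP => i; rewrite ffunE nth_mkseq // inord_val.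
exists w => //; rewrite mem_filter Zeqb_int -form_words -vw fv /=.
have -> : w = false :: behead w.
  rewrite /w /mkseq /=; congr (_ :: _).
  by apply/negbTE; move: v0; congr (~~ v _); apply: val_inj; rewrite /= inordK.
by apply: map_f; rewrite mem_words size_behead size_mkseq.
Qed.

End Lists.

(** * The two optimal Gram matrices *)

Delimit Scope Z_scope with BZ.
(** The five arguments a, b, c, d, f are the values on the diagonal inside and outside
    the first m indices, off the diagonal inside and outside them, and between. *)
Definition two_block (m : nat) (a b c d f : Z) (i j : nat) : Z :=
  if eqn i j then (if (i < m)%N then a else b)
  else if (i < m)%N then (if (j < m)%N then c else f)
  else if (j < m)%N then f else d.

Definition G9 (t : Z) := two_block 2 9 9 (1 + t) 1 1.
(** k9 t times the inverse of G9 t, for the three values t = 0, 4, -4 of interest. *)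
Definition K9 (t : Z) :=
  match t with
  | Z0 => two_block 2 16 16 (-1) (-1) (-1)
  | Zpos _ => two_block 2 64 46 (-34) (-3) (-2)
  | Zneg _ => two_block 2 64 54 26 (-3) (-6)
  end.
Definition k9 (t : Z) : Z :=
  match t with Z0 => 136 | Zpos _ => 392 | Zneg _ => 456 end.
Definition G10 := two_block 5 10 10 2 2 0.
Definition K10 := two_block 5 8 8 (-1) (-1) 0.
Definition k10 : Z := 72.

(** Column j is proportional to the last column of the inverse of the leading
    principal submatrix of size j + 1 of G9 4, which makes G9 4 times v9 lower
    triangular; v10 is obtained in the same way from G10. *)
Definition v9 (i j : nat) : Z :=
  if (j < i)%N then Z0 else
  (if eqn j 0 then 1 else if eqn j 1 then if eqn i 0 then -5 else 9
  else if eqn i j then 22 + 3 * Z.of_nat j else if (i < 2)%N then -2 else -3)%BZ.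
Definition v10 (i j : nat) : Z :=
  if (j < i)%N then Z0 else
  if i == j then (4 + Z.of_nat (if (j < 5)%N then j else (j - 5)%N))%BZ
  else if (i < 5)%N == (j < 5)%N then (-1)%BZ else Z0.
Definition lowset n (m : nat) : {set 'I_n} := [set i : 'I_n | (i < m)%N].

Lemma card_lowset n m : (m <= n)%N -> #|lowset n m| = m.
Proof.
move=> lemn; have inj : injective (widen_ord lemn).
  by move=> i j /(congr1 val)/= eij; apply: val_inj.
rewrite -[RHS](card_ord m) -(card_imset _ inj).
apply: eq_card => i; rewrite inE; apply/idP/imsetP => [im|[j _ ->]].
  by exists (Ordinal im) => //; apply: val_inj.
by rewrite /= ltn_ord.
Qed.

Lemma pattern9_zmx t : pattern_gram (pattern9 (int_of_Z t)) (lowset 9 2) [ffun=> false] =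
  zmx 9 (G9 t).
Proof.
apply/matrixP => i j; rewrite !mxE !ffunE !mul1r !inE /pattern9 /G9 /two_block.
rewrite -[eqn i j]/(i == j); case: eqP => _; first by rewrite if_same.
by case: (i < 2)%N; case: (j < 2)%N => //; rewrite [RHS](rmorphD int_of_Z).
Qed.

Lemma pattern10_zmx : pattern_gram pattern10 (lowset 10 5) [ffun=> false] = zmx 10 G10.
Proof.
apply/matrixP => i j; rewrite !mxE !ffunE !mul1r !inE /pattern10 /G10 /two_block.
rewrite -[eqn i j]/(i == j); case: eqP => _; first by rewrite if_same.
by case: (i < 5)%N; case: (j < 5)%N.
Qed.

Section Torsors.

Lemma pattern_gram_entry n phi (P P' : {set 'I_n}) (s s' : {ffun 'I_n -> bool}) i j :
  pattern_gram phi P' s' = pattern_gram phi P s ->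
  sg (s' i (+) s' j) * phi (i == j) (i \in P') (j \in P') =
  sg (s i (+) s j) * phi (i == j) (i \in P) (j \in P).
Proof. by move=> /matrixP/(_ i j); rewrite !mxE !sg_addb. Qed.

(** The entries of the pattern are positive, so the Gram matrix determines s up to a
    global sign, and it determines P as the support of its entries 5. *)
Lemma torsor9 n (P : {set 'I_n.+1}) (s : {ffun 'I_n.+1 -> bool}) : (1 < #|P|)%N ->
  #|[set x : {set 'I_n.+1} * {ffun 'I_n.+1 -> bool} |
     (#|x.1| == #|P|) &&
     (pattern_gram (pattern9 4) x.1 x.2 == pattern_gram (pattern9 4) P s)]| = 2%N.
Proof.
move=> P2; pose f (b : bool) := (P, [ffun i => s i (+) b]).
have injf : injective f.
  by move=> b b' [/ffunP/(_ ord0)]; rewrite !ffunE; case: (s ord0) b b' => -[] [].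
rewrite -[RHS]card_bool -(card_imset _ injf); apply: eq_card => -[P' s'].
rewrite inE /=; apply/andP/imsetP => [[/eqP cP' /eqP fam]|[b _ [-> ->]]]; last first.
  split=> //; apply/eqP/matrixP => i j; rewrite !mxE !ffunE -!sg_addb.
  by congr (sg _ * _); case: b (s i) (s j) => -[] [].
have ent i j : i != j ->
    (s' i (+) s' j = s i (+) s j) /\ (i \in P') && (j \in P') = (i \in P) && (j \in P).
  move=> nij; have := pattern_gram_entry i j fam; rewrite (negPf nij) /pattern9.
  by case: ((i \in P') && (j \in P')); case: ((i \in P) && (j \in P));
     case: (s' i (+) s' j); case: (s i (+) s j).
exists (s' ord0 (+) s ord0) => //; congr (_, _).
  apply/esym/eqP; rewrite eqEcard cP' leqnn andbT; apply/subsetP => x Px.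
  have [y Py nyx] : exists2 y, y \in P & y != x.
    have /card_gt0P[y] : (0 < #|P :\ x|)%N by move: P2; rewrite (cardsD1 x) Px.
    by rewrite !inE => /andP[nyx Py]; exists y.
  by have [_] := ent y x nyx; rewrite Px Py => /andP[].
apply/ffunP => i; rewrite ffunE; have [->|ni] := eqVneq i ord0.
  by case: (s' _) (s _) => -[].
have [+ _] := ent i ord0 ni.
by case: (s' i) (s i) (s' ord0) (s ord0) => -[] [] [].
Qed.

(** The zero entries determine P up to complement, and each of the two blocks
    determines the signs on it up to a common factor. *)
Lemma torsor10 n (P : {set 'I_n}) (s : {ffun 'I_n -> bool}) :
  (0 < #|P|)%N -> #|~: P| = #|P| ->
  #|[set x : {set 'I_n} * {ffun 'I_n -> bool} |
     (#|x.1| == #|P|) && (pattern_gram pattern10 x.1 x.2 == pattern_gram pattern10 P s)]| = 8%N.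
Proof.
move=> P_gt0 PC; have [p Pp] := card_gt0P P_gt0.
have [q] : exists q, q \in ~: P by apply/card_gt0P; rewrite PC.
rewrite inE => Pq.
pose f (x : bool * bool * bool) :=
  (if x.1.1 then ~: P else P, [ffun i => s i (+) (if i \in P then x.1.2 else x.2)]).
have injf : injective f.
  move=> [[a b] c] [[a' b'] c'] [/setP/(_ p) eqP /ffunP eqs].
  have := eqs p; have := eqs q; rewrite !ffunE Pp (negPf Pq) => /addbI -> /addbI ->.
  by case: a a' eqP => -[] //; rewrite inE Pp.
have -> : 8%N = #|{: bool * bool * bool}| by rewrite !card_prod !card_bool.
rewrite -(card_imset _ injf); apply: eq_card => -[P' s'].
rewrite inE /=; apply/andP/imsetP => [[/eqP cP' /eqP fam]|[[[a b] c] _ [-> ->]]]; last first.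
  split; first by case: a => /=; rewrite ?PC.
  apply/eqP/matrixP => i j; rewrite !mxE !ffunE -!sg_addb /pattern10 /=.
  have -> : (if a then ~: P else P) = [set i | a (+) (i \in P)].
    by apply/setP => x; rewrite inE; case: (a); rewrite ?inE.
  rewrite !inE; have [->|_] := eqVneq i j; first by rewrite !addbb.
  by case: a b c (i \in P) (j \in P) (s i) (s j) => -[] [] [] [] [] [].
have ent i j : i != j ->
    ((i \in P') == (j \in P')) = ((i \in P) == (j \in P)) /\
    ((i \in P) == (j \in P) -> s' i (+) s' j = s i (+) s j).
  move=> nij; have := pattern_gram_entry i j fam; rewrite (negPf nij) /pattern10.
  by case: ((i \in P') == (j \in P')); case: ((i \in P) == (j \in P));
     case: (s' i (+) s' j); case: (s i (+) s j).
exists (p \notin P', s' p (+) s p, s' q (+) s q) => //; congr (_, _).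
  apply/setP => x; rewrite /=; have [->|nxp] := eqVneq x p.
    by case: (boolP (p \in P')) => /= P'p; rewrite ?inE Pp.
  have [+ _] := ent x p nxp; rewrite Pp.
  by case: (p \in P'); rewrite /= ?inE; case: (x \in P'); case: (x \in P).
apply/ffunP => i; rewrite ffunE /=; case: ifPn => Pi.
  have [->|ni] := eqVneq i p; first by case: (s' _) (s _) => -[].
  have [_] := ent i p ni; rewrite Pi Pp => /(_ isT).
  by case: (s' i) (s i) (s' p) (s p) => -[] [] [].
have [->|ni] := eqVneq i q; first by case: (s' _) (s _) => -[].
have [_] := ent i q ni; rewrite (negPf Pi) (negPf Pq) => /(_ isT).
by case: (s' i) (s i) (s' q) (s q) => -[] [] [].
Qed.

End Torsors.

(** * Determinants and counts *)

Section Final.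

Variables (n t : nat) (phi : bool -> bool -> bool -> int) (P0 : {set 'I_n.+3}) (d : int).
Hypothesis d_gt0 : 0 < d.
Hypothesis struct : forall C : 'M[bool]_n.+3,
  2 ^+ n.+2 * d <= `|\det (sgmx C)| ->
  exists (P : {set 'I_n.+3}) s, #|P| = #|P0| /\ gram C = pattern_gram phi P s.
Hypothesis detP0 :
  \det (pattern_gram phi P0 [ffun=> false]) = (2 ^+ n.+2 * d) ^+ 2.
Hypothesis tors : forall (P : {set 'I_n.+3}) s, #|P| = #|P0| ->
  #|[set x : {set 'I_n.+3} * {ffun 'I_n.+3 -> bool} |
      (#|x.1| == #|P0|) && (pattern_gram phi x.1 x.2 == pattern_gram phi P s)]| = t.
Let X := #|[set C : 'M[bool]_n.+3 | gram C == pattern_gram phi P0 [ffun=> false]]|.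
Hypothesis X_gt0 : (0 < X)%N.

Let D_gt0 : 0 < 2 ^+ n.+2 * d.
Proof. by rewrite mulr_gt0 ?exprn_gt0. Qed.

(** A 0/1 matrix of determinant at least d gives a sign matrix in the family, whose
    determinant is known. *)
Lemma det_le_of_struct (B : 'M[bool]_n.+2) : \det (mx01 B) <= d.
Proof.
have [//|ltd] := leP (\det (mx01 B)) d.
pose C := unnormalize ([ffun=> false], [ffun=> false], B).
have detC : `|\det (sgmx C)| = 2 ^+ n.+2 * `|\det (mx01 B)| by exact: det_unnormalize.
have ledB : d < `|\det (mx01 B)| by apply: lt_le_trans ltd (ler_norm _).
have [|P [s [cP eqG]]] := struct (C := C).
  by rewrite detC ler_pM2l ?exprn_gt0 // ltW.
have /eqP := det_pattern_gram cP eqG.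
have pow_ge0 (x : int) : 0 <= x -> 0 <= 2 ^+ n.+2 * x.
  by move=> x_ge0; apply: mulr_ge0 => //; apply: exprn_ge0.
rewrite detP0 detC eqrXn2 ?pow_ge0 ?normr_ge0 ?(ltW d_gt0) //.
have nz2 : 2 ^+ n.+2 != 0 :> int by rewrite expf_neq0.
by rewrite (inj_eq (mulfI nz2)) (gt_eqF ledB).
Qed.

Lemma double_count_max :
  (#|[set B : 'M[bool]_n.+2 | \det (mx01 B) == d]| * (2 ^ n.+2 * 2 * t) =
   'C(n.+3, #|P0|) * X)%N.
Proof.
have := double_count D_gt0 struct detP0 tors.
rewrite card_large_det card_abs_det //; last exact: det_le_of_struct.
rewrite -/X => eqX; apply/eqP; rewrite -(eqn_pmul2l (expn_gt0 2 n.+3)); apply/eqP.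
move: eqX; move: (2 ^ n.+3)%N (2 ^ n.+2)%N 'C(_, _) #|_| => a b e c; lia.
Qed.

(** The maximum is attained because the double count shows that there are matrices
    of determinant d. *)
Lemma max_det01_of_struct : (#|P0| <= n.+3)%N -> max_det01 n.+2 = d.
Proof.
move=> leP0; have [B Bd] : exists B : 'M[bool]_n.+2, \det (mx01 B) = d.
  have : (0 < #|[set B : 'M[bool]_n.+2 | \det (mx01 B) == d]|)%N.
    rewrite lt0n; apply: contraTneq X_gt0 => c0.
    have := double_count_max; rewrite c0 mul0n => /esym/eqP.
    by rewrite muln_eq0 -leqn0 leqNgt bin_gt0 leP0 /= => /eqP->.
  by case/card_gt0P => B; rewrite inE => /eqP; exists B.
apply/eqP; rewrite eq_le -{2}Bd max_det01_ge andbT.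
by rewrite /max_det01; case: arg_maxP => // C _ _; exact: det_le_of_struct.
Qed.

Lemma num_max_det01_of_struct : (#|P0| <= n.+3)%N ->
  (num_max_det01 n.+2 * (2 ^ n.+2 * 2 * t) = 'C(n.+3, #|P0|) * X)%N.
Proof. by move=> leP0; rewrite /num_max_det01 max_det01_of_struct // double_count_max. Qed.

End Final.

Lemma nat_of_bin_mul (a b : N) : nat_of_bin (N.mul a b) = (nat_of_bin a * nat_of_bin b)%N.
Proof. by case: a b => [|p] [|q] //=; rewrite ?muln0 // nat_of_mul_pos. Qed.

Lemma nat_of_pos_gt0 p : (0 < nat_of_pos p)%N.
Proof. by elim: p => //= p IHp; rewrite NatTrec.doubleE double_gt0. Qed.

(** The counts are far too large to be evaluated in unary, so the final equations
    are compared in binary. *)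
Lemma nat_of_bin_cancel (c : nat) (a b k : N) :
  N.eqb a N0 = false -> N.eqb b (N.mul k a) ->
  (c * nat_of_bin a = nat_of_bin b)%N -> c = nat_of_bin k.
Proof.
case: a => // p _ /N.eqb_spec ->; rewrite nat_of_bin_mul => /eqP.
by rewrite eqn_pmul2r ?nat_of_pos_gt0 // => /eqP.
Qed.

Lemma fact9 : 9`! = nat_of_bin 362880%num.
Proof.
have fact7 : 7`! = nat_of_bin 5040%num by [].
rewrite (factS 8) (factS 7) fact7.
rewrite -(nat_of_bin_mul 8%num 5040%num) -(nat_of_bin_mul 9%num (N.mul 8%num 5040%num)).
exact: (congr1 nat_of_bin).
Qed.

Lemma fact10 : 10`! = nat_of_bin 3628800%num.
Proof.
rewrite (factS 9) fact9 -(nat_of_bin_mul 10%num 362880%num).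
exact: (congr1 nat_of_bin).
Qed.

Lemma int_of_Z_mul a b : int_of_Z (Z.mul a b) = int_of_Z a * int_of_Z b.
Proof. exact: (rmorphM int_of_Z). Qed.

Lemma int_of_Z_14336 : int_of_Z (Z.mul 14336 14336) = (2 ^+ 8 * 56) ^+ 2.
Proof.
have defD : 14336%BZ = 2 ^+ 8 * 56 :> Z by [].
by rewrite int_of_Z_mul -expr2 defD rmorphM rmorphXn.
Qed.

Lemma int_of_Z_73728 : int_of_Z (Z.mul 73728 73728) = (2 ^+ 9 * 144) ^+ 2.
Proof.
have defD : 73728%BZ = 2 ^+ 9 * 144 :> Z by [].
by rewrite int_of_Z_mul -expr2 defD rmorphM rmorphXn.
Qed.

Lemma det_pattern9 :
  \det (pattern_gram (pattern9 4) (lowset 9 2) [ffun=> false]) = (2 ^+ 8 * 56) ^+ 2.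
Proof.
have cert : trig_cert 9 (G9 4) v9 (Z.mul 14336 14336) by vm_compute.
rewrite (pattern9_zmx 4) -int_of_Z_14336.
exact: (det_zmx_trig cert).
Qed.

Lemma det_pattern10 :
  \det (pattern_gram pattern10 (lowset 10 5) [ffun=> false]) = (2 ^+ 9 * 144) ^+ 2.
Proof.
have cert : trig_cert 10 G10 v10 (Z.mul 73728 73728) by vm_compute.
rewrite pattern10_zmx -int_of_Z_73728.
exact: (det_zmx_trig cert).
Qed.

Lemma card_pattern9_pos :
  #|[set C | gram C == pattern_gram (pattern9 4) (lowset 9 2) [ffun=> false]]| =
  (2 ^ 9 * (9`! * 30))%N.
Proof.
have cert : inv_pair 8 (K9 4) (G9 4) (k9 4) by vm_compute.
have count : count_cliques (edge_words (zrows 8 (K9 4))) 9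
    (vertex_words 8 (zrows 8 (K9 4)) (k9 4)) = 30%N by vm_compute.
by rewrite (pattern9_zmx 4) (card_gram_words cert) count.
Qed.

Lemma card_pattern9_zero :
  #|[set C | gram C == pattern_gram (pattern9 0) (lowset 9 2) [ffun=> false]]| = 0%N.
Proof.
have cert : inv_pair 8 (K9 0) (G9 0) (k9 0) by vm_compute.
rewrite (pattern9_zmx 0) (card_gram_words cert).
have -> : vertex_words 8 (zrows 8 (K9 0)) (k9 0) = [::] by vm_compute.
by rewrite count_cliques_nil !muln0.
Qed.

Lemma card_pattern9_neg :
  #|[set C | gram C == pattern_gram (pattern9 (- 4)) (lowset 9 2) [ffun=> false]]| = 0%N.
Proof.
have cert : inv_pair 8 (K9 (-4)) (G9 (-4)) (k9 (-4)) by vm_compute.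
rewrite (pattern9_zmx (-4)) (card_gram_words cert).
have -> : vertex_words 8 (zrows 8 (K9 (-4))) (k9 (-4)) = [::] by vm_compute.
by rewrite count_cliques_nil !muln0.
Qed.

Lemma card_pattern10 :
  #|[set C | gram C == pattern_gram pattern10 (lowset 10 5) [ffun=> false]]| =
  (2 ^ 10 * (10`! * 120))%N.
Proof.
have cert : inv_pair 9 K10 G10 k10 by vm_compute.
have count : count_cliques (edge_words (zrows 9 K10)) 10
    (vertex_words 9 (zrows 9 K10) k10) = 120%N by vm_compute.
by rewrite pattern10_zmx (card_gram_words cert) count.
Qed.

(** The patterns with t = 0 and t = -4 are the Gram matrix of no sign matrix. *)
Lemma large_det9_gram (C : 'M[bool]_9) : 2 ^+ 8 * 56 <= `|\det (sgmx C)| ->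
  exists (P : {set 'I_9}) s, #|P| = #|lowset 9 2| /\ gram C = pattern_gram (pattern9 4) P s.
Proof.
move=> /large_det9_pattern[P [s [t [P2 t3 eqG]]]]; exists P, s; rewrite card_lowset //.
have cP : #|P| = #|lowset 9 2| by rewrite card_lowset.
have pos : (0 < #|[set D | gram D == pattern_gram (pattern9 t) (lowset 9 2) [ffun=> false]]|)%N.
  by rewrite -(card_pattern_gram _ s cP); apply/card_gt0P; exists C; rewrite inE eqG.
case: t3 eqG pos => -> //; first by rewrite card_pattern9_zero.
by rewrite card_pattern9_neg.
Qed.

Lemma large_det10_gram (C : 'M[bool]_10) : 2 ^+ 9 * 144 <= `|\det (sgmx C)| ->
  exists (P : {set 'I_10}) s, #|P| = #|lowset 10 5| /\ gram C = pattern_gram pattern10 P s.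
Proof. by move=> /large_det10_pattern[P [s]]; rewrite card_lowset //; exists P, s. Qed.

Lemma num_max_det01_8E :
  (num_max_det01 8 * (2 ^ 8 * 2 * 2) = 36 * (2 ^ 9 * (9`! * 30)))%N.
Proof.
have c2 : #|lowset 9 2| = 2%N by exact: card_lowset.
have tors (P : {set 'I_9}) s : #|P| = #|lowset 9 2| ->
    #|[set x : {set 'I_9} * {ffun 'I_9 -> bool} | (#|x.1| == #|lowset 9 2|) &&
       (pattern_gram (pattern9 4) x.1 x.2 == pattern_gram (pattern9 4) P s)]| = 2%N.
  by move=> cP; rewrite -cP torsor9 // cP c2.
have X_gt0 : (0 < #|[set C | gram C ==
    pattern_gram (pattern9 4) (lowset 9 2) [ffun=> false]]|)%N.
  by rewrite card_pattern9_pos muln_gt0 expn_gt0 muln_gt0 fact_gt0.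
have le9 : (#|lowset 9 2| <= 9)%N by rewrite c2.
have := @num_max_det01_of_struct 6 2 _ _ 56 isT large_det9_gram det_pattern9 tors X_gt0 le9.
by rewrite card_pattern9_pos c2.
Qed.

Lemma num_max_det01_9E :
  (num_max_det01 9 * (2 ^ 9 * 2 * 8) = 252 * (2 ^ 10 * (10`! * 120)))%N.
Proof.
have c5 : #|lowset 10 5| = 5%N by exact: card_lowset.
have tors (P : {set 'I_10}) s : #|P| = #|lowset 10 5| ->
    #|[set x : {set 'I_10} * {ffun 'I_10 -> bool} | (#|x.1| == #|lowset 10 5|) &&
       (pattern_gram pattern10 x.1 x.2 == pattern_gram pattern10 P s)]| = 8%N.
  move=> cP; rewrite -cP torsor10 // cP c5 //.
  by have := cardsC P; rewrite cP c5 card_ord => /eqP; rewrite -[10%N]/(5 + 5)%N eqn_add2l => /eqP.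
have X_gt0 : (0 < #|[set C | gram C ==
    pattern_gram pattern10 (lowset 10 5) [ffun=> false]]|)%N.
  by rewrite card_pattern10 muln_gt0 expn_gt0 muln_gt0 fact_gt0.
have le10 : (#|lowset 10 5| <= 10)%N by rewrite c5.
have := @num_max_det01_of_struct 7 8 _ _ 144 isT large_det10_gram det_pattern10 tors X_gt0 le10.
by rewrite card_pattern10 c5.
Qed.

Close Scope ring_scope.

Theorem mainTheorem5 :
  num_max_det01 8 = nat_of_bin 195955200%num /\
  num_max_det01 9 = nat_of_bin 13716864000%num.
Proof.
split.
- apply: (@nat_of_bin_cancel _ 1024%num
    (N.mul 36%num (N.mul 512%num (N.mul 362880%num 30%num)))); [by [] | by [] | ].
  rewrite !nat_of_bin_mul -fact9.
  have -> : nat_of_bin 1024%num = (2 ^ 8 * 2 * 2)%N by [].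
  have -> : nat_of_bin 512%num = (2 ^ 9)%N by [].
  exact: num_max_det01_8E.
apply: (@nat_of_bin_cancel _ 8192%num
    (N.mul 252%num (N.mul 1024%num (N.mul 3628800%num 120%num)))); [by [] | by [] | ].
rewrite !nat_of_bin_mul -fact10.
have -> : nat_of_bin 8192%num = (2 ^ 9 * 2 * 8)%N by [].
have -> : nat_of_bin 1024%num = (2 ^ 10)%N by [].
exact: num_max_det01_9E.
Qed.
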